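(* Let $k$ be a division ring, let $n \ge 0$, and let $S \in \mathbf{SPS}^n(k)$, with unique maximal ideal $\mathfrak{n}$. Then $\mathrm{Kdim}(S) = \mathrm{Kdim}(\mathrm{gr}(S)) = n$, where $\mathrm{gr}(S)$ is the graded ring associated to the $\mathfrak{n}$-adic filtration of $S$ and $\mathrm{Kdim}$ denotes (right, equivalently left) Krull dimension in the sense of Gabriel–Rentschler.
   Context: A ring $R$ is local if it has a unique maximal two-sided ideal $\mathfrak{m}$ and $R/\mathfrak{m}$ is simple artinian; a complete local ring is a local ring $(R,\mathfrak{m})$ that is complete and separated in the $\mathfrak{m}$-adic topology (a division ring is a complete local ring with $\mathfrak{m}=0$). A skew derivation $(\sigma,\delta)$ of $R$ consists of a ring automorphism $\sigma$ of $R$ and an additive map $\delta:R\to R$ with $\delta(ab)=\delta(a)b+\sigma(a)\delta(b)$; it is local if $\sigma(\mathfrak{m})\subseteq\mathfrak{m}$, $\delta(R)\subseteq\mathfrak{m}$ and $\delta(\mathfrak{m})\subseteq\mathfrak{m}^2$. For a local skew derivation, the skew power series ring $R[[x;\sigma,\delta]]$ is the set of formal series $\sum_{i\ge0} r_ix^i$ ($r_i\in R$), isomorphic to $R[[x]]$ as a topological left $R$-module, with the (well-defined) multiplication extending that of $R$, with $x^ix^j=x^{i+j}$ and $xa=\sigma(a)x+\delta(a)$ for $a\in R$. $\mathbf{SPS}(R)$ denotes the class of such rings $R[[x;\sigma,\delta]]$ with $(\sigma,\delta)$ local; such a ring is again a complete local ring. Inductively, $\mathbf{SPS}^1(R)=\mathbf{SPS}(R)$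 and $S\in\mathbf{SPS}^n(R)$ iff $S\in\mathbf{SPS}(T)$ for some $T\in\mathbf{SPS}^{n-1}(R)$; $\mathbf{SPS}^0(R)=\{R\}$. *)

(* Defs.v *)
From mathcomp Require Import all_boot all_algebra.
Set Implicit Arguments. Unset Strict Implicit. Unset Printing Implicit Defensive.
Import GRing.Theory.
Local Open Scope ring_scope.

Section RingDefs.
Variable R : nzRingType.

Definition division_ring : Prop :=
  forall x : R, x != 0 -> exists y, x * y = 1 /\ y * x = 1.

Definition ideal (I : R -> Prop) : Prop :=
  [/\ I 0, (forall x y, I x -> I y -> I (x + y)), (forall x, I x -> I (- x)),
      (forall x r, I x -> I (r * x)) & (forall x r, I x -> I (x * r))].

Definition side_ideal (right : bool) (I : R -> Prop) : Prop :=
  [/\ I 0, (forall x y, I x -> I y -> I (x + y)), (forall x, I x -> I (- x)) &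
      (forall x r, I x -> I (if right then x * r else r * x))].

Definition maximal_ideal (m : R -> Prop) : Prop :=
  [/\ ideal m, ~ m 1 &
      forall J, ideal J -> (forall x, m x -> J x) -> (forall x, J x -> m x) \/ J 1].

Fixpoint ideal_pow (I : R -> Prop) (n : nat) : R -> Prop :=
  match n with
  | 0 => fun _ => True
  | n'.+1 => fun x => exists (N : nat) (a b : nat -> R),
      (forall i, ideal_pow I n' (a i) /\ I (b i)) /\ x = \sum_(i < N) a i * b i
  end.

Definition quotient_artinian (m : R -> Prop) : Prop :=
  forall c : nat -> R -> Prop,
    (forall i, side_ideal true (c i)) -> (forall i x, m x -> c i x) ->
    (forall i x, c i.+1 x -> c i x) ->
    exists N, forall i, (N <= i)%N -> forall x, c N x -> c i x.

(* local ring: unique maximal two-sided ideal m with R/m simple artinian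
   (simplicity of R/m is automatic from maximality of m) *)
Definition local_ring (m : R -> Prop) : Prop :=
  [/\ maximal_ideal m,
      (forall J, maximal_ideal J -> forall x, J x <-> m x) &
      quotient_artinian m].

Definition madic_lim (m : R -> Prop) (u : nat -> R) (l : R) : Prop :=
  forall N, exists M, forall i, (M <= i)%N -> ideal_pow m N (u i - l).

Definition madic_cauchy (m : R -> Prop) (u : nat -> R) : Prop :=
  forall N, exists M, forall i j, (M <= i)%N -> (M <= j)%N ->
    ideal_pow m N (u i - u j).

Definition complete_local (m : R -> Prop) : Prop :=
  [/\ local_ring m,
      (forall x, (forall N, ideal_pow m N x) -> x = 0) &
      (forall u, madic_cauchy m u -> exists l, madic_lim m u l)].

Definition local_skew_derivation (m : R -> Prop) (sigma delta : R -> R) : Prop :=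
  [/\ (forall a b, sigma (a + b) = sigma a + sigma b),
      (forall a b, sigma (a * b) = sigma a * sigma b),
      sigma 1 = 1 & bijective sigma] /\
  [/\ (forall a b, delta (a + b) = delta a + delta b),
      (forall a b, delta (a * b) = delta a * b + sigma a * delta b),
      (forall a, m a -> m (sigma a)), (forall a, m (delta a)) &
      (forall a, m a -> ideal_pow m 2 (delta a))].

(* x^i * b = \sum_k (sdw i k b) x^k in R[[x; sigma, delta]] *)
Fixpoint sdw (sigma delta : R -> R) (i k : nat) (b : R) : R :=
  match i with
  | 0 => if k == 0%N then b else 0
  | i'.+1 => (match k with 0 => 0 | k'.+1 => sigma (sdw sigma delta i' k' b) end)
             + delta (sdw sigma delta i' k b)
  end.

(* N-th partial sum (over i < N) of the coefficient of x^t in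
   (\sum_i f i x^i) * (\sum_j g j x^j) *)
Definition sps_mul_partial (sigma delta : R -> R) (f g : nat -> R) (t N : nat) : R :=
  \sum_(i < N) \sum_(j < t.+1) f i * sdw sigma delta i (t - j) (g j).

End RingDefs.

(* S belongs to SPS(R): S is isomorphic to R[[x; sigma, delta]] for a local
   skew derivation of the complete local ring R.  Elements of R[[x;sigma,delta]]
   are coefficient sequences nat -> R; phi is the isomorphism. *)
Definition inSPS (R S : nzRingType) : Prop :=
  exists (m : R -> Prop) (sigma delta : R -> R) (phi : (nat -> R) -> S),
    [/\ complete_local m, local_skew_derivation m sigma delta & bijective phi] /\
    [/\ (forall f g, phi (fun i => f i + g i) = phi f + phi g),
        phi (fun i => if i == 0%N then 1 else 0) = 1 &
        (forall f g h,
           (forall t, madic_lim m (sps_mul_partial sigma delta f g t) (h t)) ->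
           phi h = phi f * phi g)].

Inductive SPSn (k : nzRingType) : nat -> nzRingType -> Prop :=
| SPSn0 : SPSn k 0 k
| SPSnS (n : nat) (T S : nzRingType) : SPSn k n T -> inSPS T S -> SPSn k n.+1 S.

(* G is (isomorphic to) the graded ring gr(S) = (+)_i n^i / n^(i+1) of the
   n-adic filtration; phi i induces n^i/n^(i+1) ~ i-th homogeneous component *)
Definition assoc_graded (S : nzRingType) (nn : S -> Prop) (G : nzRingType) : Prop :=
  exists phi : nat -> S -> G,
    [/\ (forall i a b, ideal_pow nn i a -> ideal_pow nn i b ->
            phi i (a + b) = phi i a + phi i b),
        (forall i a, ideal_pow nn i a -> (phi i a = 0 <-> ideal_pow nn i.+1 a)),
        (forall i j a b, ideal_pow nn i a -> ideal_pow nn j b ->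
            phi i a * phi j b = phi (i + j)%N (a * b)),
        (forall g : G, exists (N : nat) (a : nat -> S),
            (forall i, ideal_pow nn i (a i)) /\ g = \sum_(i < N) phi i (a i)) &
        (forall (N : nat) (a : nat -> S), (forall i, ideal_pow nn i (a i)) ->
            \sum_(i < N) phi i (a i) = 0 -> forall i, (i < N)%N -> phi i (a i) = 0)].

(* Deviation of the lattice of one-sided ideals (Gabriel-Rentschler), finite
   values.  devlt right n A B  <->  the interval [A,B] of right (resp. left)
   ideals has deviation < n  (deviation -oo means A = B). *)
Fixpoint devlt (G : nzRingType) (right : bool) (n : nat) (A B : G -> Prop) : Prop :=
  match n with
  | 0 => forall x, B x -> A x
  | p.+1 => forall c : nat -> G -> Prop,
      (forall i, side_ideal right (c i)) ->
      (forall i x, A x -> c i x) -> (forall i x, c i x -> B x) ->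
      (forall i x, c i.+1 x -> c i x) ->
      exists N, forall i, (N <= i)%N -> devlt right p (c i.+1) (c i)
  end.

Definition Kdim_eq (G : nzRingType) (right : bool) (n : nat) : Prop :=
  devlt right n.+1 (fun x : G => x = 0) (fun _ => True) /\
  ~ devlt right n (fun x : G => x = 0) (fun _ => True).

(* Main.v *)
Require Import Defs.
From mathcomp Require Import all_boot all_algebra.
From mathcomp Require Import zify.
From Stdlib Require Import Classical ClassicalEpsilon FunctionalExtensionality.
From Stdlib Require Import PropExtensionality.
Set Implicit Arguments. Unset Strict Implicit. Unset Printing Implicit Defensive.
Import GRing.Theory.

(* Upper bound. Iterating leading coefficients in the power series variables
   attaches to every nonzero homogeneous element of gr(S) a leading exponent in
   N^n, and to every right ideal of S or gr(S) an upset of N^n. This map is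
   strictly monotone (for S because, by Dickson's lemma and completeness, a right
   ideal is generated by finitely many elements carrying the minimal exponents),
   and the upsets of N^n have deviation at most n: on a coordinate face met by all
   terms of a descending chain, successive terms differ in smaller dimension only.

   Lower bound. For closed right ideals A < B of R, the right ideals A[[x]] and
   B[[x]] of R[[x; sigma, delta]] are separated by an infinite chain, so by
   induction the deviation grows by at least one with each variable; passing to
   associated graded ideals is strictly monotone on closed right ideals, which
   transfers the bound to gr(S).

   The left-handed statements follow since both constructions are stable under
   passing to the converse ring. *)

(** * Deviation of the upsets of N^n *)

Section Exponents.
Variable n : nat.
Implicit Types (a b c : nat -> nat) (T : seq nat) (U : (nat -> nat) -> Prop).

(* Exponent vectors in N^n are functions [nat -> nat] of which only the values
   below [n] matter. *)
Definition exp_le a b := forall s, s < n -> a s <= b s.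

Definition upset U := forall a b, U a -> exp_le a b -> U b.

Definition face (f : (nat -> nat) * seq nat) b :=
  forall s, s < n -> f.1 s <= b s /\ (s \notin f.2 -> b s = f.1 s).

(** Dimension below [p]. The strict bound matches the convention of [devlt], and [small 0] forces
    [U] to be empty. *)
Definition small p U := exists2 L : seq ((nat -> nat) * seq nat),
  (forall f, List.In f L -> size f.2 < p) &
  forall b, U b -> exists2 f, List.In f L & face f b.

Definition upd a s v := fun t => if t == s then v else a t.

(** A point of the face not above [b] is smaller than [b] in some free coordinate; freezing that
    coordinate at one of finitely many values costs one dimension. *)
Lemma face_split a T b : face (a, T) b ->
  small (size T) (fun c => face (a, T) c /\ ~ exp_le b c).
Proof.
move=> Fb.
exists (List.flat_map (fun s => List.map (fun v => (upd a s v, rem s T))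
                                 (iota 0 (b s))) T).
- move=> f /List.in_flat_map [s [sT /List.in_map_iff [v [<- _]]]] /=.
  have sT' : s \in T by elim: T sT {Fb} => //= t T IH [->|/IH];
    rewrite inE ?eqxx // => ->; rewrite orbT.
  by rewrite size_rem //; case: T sT' {sT Fb}.
move=> c [Fc nbc].
have [s [sn lt_s]] : exists s, s < n /\ c s < b s.
  apply: NNPP => H; apply: nbc => s sn; rewrite leqNgt; apply/negP => lt_s.
  by apply: H; exists s.
have sT : s \in T.
  apply/negPn/negP => sT; have [_ /(_ sT) /= eb] := Fb _ sn.
  by have [_ /(_ sT) /= ec] := Fc _ sn; move: lt_s; rewrite eb ec ltnn.
have in_In (S : seq nat) t : t \in S -> List.In t S.
  by elim: S => //= u S IH; rewrite inE => /orP[/eqP->|/IH]; [left|right].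
exists (upd a s (c s), rem s T).
  apply/List.in_flat_map; exists s; split; first exact: in_In.
  by apply/List.in_map_iff; exists (c s); split=> //; apply: in_In; rewrite mem_iota.
move=> t tn /=; rewrite /upd; case: eqP => [->//|/eqP nts].
have [/= le_a eq_a] := Fc _ tn; split=> // tT; apply: eq_a.
apply: contra tT => tT; move: nts tT; elim: (T) => //= u T' IH nts.
by rewrite !inE; case: (eqVneq u s) => [->|nus]; rewrite ?inE ?(negPf nts) //=
  => /orP[->//|/(IH nts)->]; rewrite orbT.
Qed.

Lemma small_leq p q U : p <= q -> small p U -> small q U.
Proof. by move=> pq [L sz cov]; exists L => // f /sz /leq_trans; apply. Qed.

Lemma small_sub p (U V : (nat -> nat) -> Prop) :
  (forall b, V b -> U b) -> small p U -> small p V.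
Proof. by move=> VU [L sz cov]; exists L => // b /VU /cov. Qed.

Lemma small_empty p U : (forall b, ~ U b) -> small p U.
Proof. by move=> U0; exists [::] => // b /U0. Qed.

Lemma small_union p (U V : (nat -> nat) -> Prop) :
  small p U -> small p V -> small p (fun b => U b \/ V b).
Proof.
move=> [L szL covL] [M szM covM]; exists (L ++ M).
  by move=> f /List.in_app_iff [/szL|/szM].
by move=> b [/covL|/covM] [f fL fb]; exists f => //; apply/List.in_app_iff; [left|right].
Qed.

Lemma small_full U : small n.+1 U.
Proof.
exists [:: (fun=> 0, iota 0 n)] => [f [<-|[]]|b _] /=; first by rewrite size_iota.
exists (fun=> 0, iota 0 n); first by left.
by move=> s sn /=; split=> //; rewrite mem_iota sn.
Qed.

(** Induction on the dimension: one point [b0] of [U] on the face takes care of all points above it,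
    and [face_split] puts the rest on finitely many smaller faces. *)
Lemma dickson_face p a T U : upset U -> size T < p ->
  exists2 L, (forall b, List.In b L -> U b) &
  forall b, U b -> face (a, T) b -> exists2 c, List.In c L & exp_le c b.
Proof.
move=> upU; elim: p a T => // p IH a T; rewrite ltnS => szT.
have [[b0 [Ub0 Fb0]]|none] := classic (exists b, U b /\ face (a, T) b); last first.
  by exists [::] => // b Ub Fb; case: none; exists b.
have [L0 szL0 cov0] := face_split Fb0.
have {szL0} : forall f, List.In f L0 -> size f.2 < p.
  by move=> f /szL0 /leq_trans; apply.
suff /[apply] -[L LU covL] : (forall f, List.In f L0 -> size f.2 < p) ->
  exists2 L, (forall b, List.In b L -> U b) &
  forall b, U b -> (exists2 f, List.In f L0 & face f b) ->
     exists2 c, List.In c L & exp_le c b.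
  exists (b0 :: L) => [b [<-//|/LU//]|b Ub Fb].
  have [le_b|nle] := classic (exp_le b0 b); first by exists b0 => //; left.
  by have [c cL le_c] := covL b Ub (cov0 b (conj Fb nle)); exists c => //; right.
elim: L0 {cov0} => [|f L0 IHL] sz; first by exists [::] => // b _ [].
have [g gf|L LU covL] := IHL; first by apply: sz; right.
have [|M MU covM] := IH f.1 f.2; first by apply: sz; left.
exists (L ++ M) => [b /List.in_app_iff [/LU|/MU]//|b Ub [g [<-|gL0] gb]].
  have [|c cM le_c] := covM b Ub; first by case: (f) gb.
  by exists c => //; apply/List.in_app_iff; right.
have [|c cL le_c] := covL b Ub; first by exists g.
by exists c => //; apply/List.in_app_iff; left.
Qed.

Lemma dickson U : upset U ->
  exists2 L, (forall b, List.In b L -> U b) &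
  forall b, U b -> exists2 c, List.In c L & exp_le c b.
Proof.
move=> upU; have [L LU cov] := dickson_face (fun=> 0) upU (ltnSn (size (iota 0 n))).
exists L => // b Ub; apply: cov => // s sn /=.
by split=> //; rewrite mem_iota sn.
Qed.

(* On a face that meets every term of a descending chain of upsets, two
   successive terms differ only by a set of smaller dimension. *)
Lemma small_chain p U (c : nat -> (nat -> nat) -> Prop) :
  small p.+1 U -> (forall i, upset (c i)) -> (forall i b, c i b -> ~ c i.+1 b -> U b) ->
  (forall i b, c i.+1 b -> c i b) ->
  exists N, forall i, N <= i -> small p (fun b => c i b /\ ~ c i.+1 b).
Proof.
move=> [L sz cov] upc cU desc.
have mono i j b : i <= j -> c j b -> c i b.
  by move=> /subnK <-; elim: (j - i) => //= k IH /desc.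
suff [N HN] : exists N, forall i, N <= i ->
    small p (fun b => (exists2 f, List.In f L & face f b) /\ (c i b /\ ~ c i.+1 b)).
  exists N => i /HN; apply: small_sub => b [cb ncb]; split=> //.
  by apply: cov; apply: cU cb ncb.
elim: L sz {cov} => [|[a T] L IH] sz.
  by exists 0 => i _; apply: small_empty => b [[]].
have [f fL|N1 HN1] := IH; first by apply: sz; right.
have szT : size T <= p by rewrite -ltnS; apply: (sz (a, T)); left.
have [N2 HN2] : exists N, forall i, N <= i ->
    small p (fun b => face (a, T) b /\ (c i b /\ ~ c i.+1 b)).
  (* Either the chain eventually leaves the face, or every term meets it. In the second case
     [c i.+1] contains all points of the face above some [b], and [face_split] bounds what is left,
     from index 0 on. *)
  have [[N HN]|none] := classic (exists N, forall b, face (a, T) b -> ~ c N b).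
    exists N => i Ni; apply: small_empty => b [Fb [cb _]].
    by apply: (HN b Fb); apply: mono cb.
  exists 0 => i _; have [b [Fb cb]] : exists b, face (a, T) b /\ c i.+1 b.
    apply: NNPP => H; apply: none; exists i.+1 => b Fb cb.
    by apply: H; exists b.
  apply: small_leq szT _; apply: small_sub (face_split Fb) => d [Fd [_ ncd]].
  by split=> // le_bd; apply: ncd; apply: upc cb le_bd.
exists (N1 + N2) => i le_i.
have le1 : N1 <= i by lia.
have le2 : N2 <= i by lia.
apply: small_sub (small_union (HN1 i le1) (HN2 i le2)) => b [[f [<-|fL] fb] H].
  by right.
by left; split=> //; exists f.
Qed.

(** * Total degree and lexicographic order on exponents *)

Definition deg a := \sum_(s < n) a s.

Lemma deg_leq a b : exp_le a b -> deg a <= deg b.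
Proof. by move=> le_ab; apply: leq_sum => s _; apply: le_ab. Qed.

End Exponents.

Lemma deg_eq n a b : (forall s, s < n -> a s = b s) -> deg n a = deg n b.
Proof. by move=> eab; apply: eq_bigr => s _; apply: eab. Qed.

Lemma degS n a : deg n.+1 a = deg n a + a n.
Proof. by rewrite /deg big_ord_recr. Qed.

(** The last coordinate is compared first, since the variable adjoined last is the most significant
    one. *)
Fixpoint lex_lt n (a b : nat -> nat) : Prop :=
  match n with
  | 0 => False
  | p.+1 => a p < b p \/ a p = b p /\ lex_lt p a b
  end.

Lemma lex_lt_eq n a b a' b' : (forall s, s < n -> a s = a' s) ->
  (forall s, s < n -> b s = b' s) -> lex_lt n a b -> lex_lt n a' b'.
Proof.
elim: n => //= n IH ea eb; rewrite ea // eb // => -[lt_n|[eq_n lt]]; [by left|right].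
by split=> //; apply: IH lt => s sn; [apply: ea|apply: eb]; apply: ltnW.
Qed.

(** A descent that lowers the last coordinate may change the others freely, hence an outer induction
    on a bound [v] for it and an inner one on the remaining coordinates. *)
Lemma lex_lt_wf n : well_founded (lex_lt n).
Proof.
elim: n => [a|n IH]; first by constructor.
suff H v : forall a, a n <= v -> Acc (lex_lt n.+1) a by move=> a; exact: H (leqnn _).
elim: v => [|v IHv] a.
  elim: a / (IH a) => a _ IHa av; constructor => b /= [ltb|[eb lb]]; first by lia.
  by apply: IHa => //; rewrite eb.
elim: a / (IH a) => a _ IHa av; constructor => b /= [ltb|[eb lb]].
  by apply: IHv; lia.
by apply: IHa => //; rewrite eb.
Qed.

Local Open Scope ring_scope.

(** * Deviation bounds from a strictly monotone map to upsets *)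

Section Deviation.
Variables (G : nzRingType) (n : nat).
Variable ini : (G -> Prop) -> (nat -> nat) -> Prop.
Hypothesis ini_upset : forall I, side_ideal true I -> upset n (ini I).
Hypothesis ini_mono : forall I J : G -> Prop, (forall x, I x -> J x) ->
  forall a, ini I a -> ini J a.
Hypothesis ini_strict : forall I J, side_ideal true I -> side_ideal true J ->
  (forall x, I x -> J x) -> (forall a, ini J a -> ini I a) -> forall x, J x -> I x.

(** [ini] carries a chain of right ideals to a chain of upsets, where [small_chain] lowers the
    dimension; at [p = 0] the difference of the upsets is empty and strictness applies. *)
Lemma devlt_small p (A B : G -> Prop) : side_ideal true A -> side_ideal true B ->
  (forall x, A x -> B x) -> small n p (fun a => ini B a /\ ~ ini A a) ->
  devlt true p A B.
Proof.
elim: p A B => [|p IH] A B idA idB AB smallAB.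
  apply: ini_strict => // a Ba; apply: NNPP => nAa.
  by have [[|f L] sz cov] := smallAB; [case: (cov a)|have := sz f (or_introl erefl)].
move=> c idc Ac cB desc /=.
have [|i b cb ncb|i|N HN] := small_chain smallAB (c := fun i => ini (c i)).
- by move=> i; apply: ini_upset.
- split; first exact: ini_mono (cB i) _ cb.
  by move=> Ab; apply: ncb; apply: ini_mono Ab; apply: Ac.
- by apply: ini_mono; apply: desc.
by exists N => i Ni; exact: IH (idc _) (idc _) (desc i) (HN i Ni).
Qed.

Lemma devlt_exponents (A B : G -> Prop) : side_ideal true A -> side_ideal true B ->
  (forall x, A x -> B x) -> devlt true n.+1 A B.
Proof. by move=> idA idB AB; apply: devlt_small => //; apply: small_full. Qed.

End Deviation.

(** * Filtered rings and skew extensions *)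

Record filtration (R : nzRingType) (F : nat -> R -> Prop) : Prop := Filtration {
  filt0 : forall x, F 0%N x;
  filt_zero : forall i, F i 0;
  filtD : forall i x y, F i x -> F i y -> F i (x + y);
  filtN : forall i x, F i x -> F i (- x);
  filtS : forall i x, F i.+1 x -> F i x;
  filtM : forall i j x y, F i x -> F j y -> F (i + j)%N (x * y) }.

Section Filtration.
Variables (R : nzRingType) (F : nat -> R -> Prop).
Hypothesis filtF : filtration F.

Lemma filtB i x y : F i x -> F i y -> F i (x - y).
Proof. by move=> Fx Fy; apply: filtD => //; apply: filtN. Qed.

Lemma filt_leq i j x : (i <= j)%N -> F j x -> F i x.
Proof. by move=> /subnK <-; elim: (j - i)%N => //= k IH /(filtS filtF). Qed.

Lemma filt_sum i I (r : seq I) (P : pred I) (f : I -> R) :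
  (forall k, P k -> F i (f k)) -> F i (\sum_(k <- r | P k) f k).
Proof.
move=> Ff; elim/big_rec: _ => [|k x Pk Fx]; first exact: filt_zero.
by apply: filtD => //; apply: Ff.
Qed.

Lemma filtMl i x y : F i y -> F i (x * y).
Proof. by move=> Fy; apply: (filtM (i := 0) filtF) => //; apply: filt0. Qed.

Lemma filtMr i x y : F i x -> F i (x * y).
Proof. by move=> Fx; rewrite -(addn0 i); apply: filtM => //; apply: filt0. Qed.

Lemma filtX i x : F 1%N x -> F i (x ^+ i).
Proof.
move=> Fx; elim: i => [|i IH]; first exact: filt0.
by rewrite exprS -add1n; apply: filtM.
Qed.

Lemma filt_converse : filtration (F : nat -> R^c -> Prop).
Proof.
case: filtF => *; split=> //= i j x y Fx Fy.
by rewrite addnC; apply: filtM filtF _ _ _ _ Fy Fx.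
Qed.

End Filtration.

Definition separated (R : nzRingType) (F : nat -> R -> Prop) :=
  forall x, (forall N, F N x) -> x = 0.

Definition filt_complete (R : nzRingType) (F : nat -> R -> Prop) :=
  forall u : nat -> R,
  (forall N, exists M, forall i j, (M <= i)%N -> (M <= j)%N -> F N (u i - u j)) ->
  exists l, forall N, exists M, forall i, (M <= i)%N -> F N (u i - l).

(* What remains of [S = R[[x; sigma, delta]]] at the level of associated graded
   rings: the derivation only survives as "[delta] raises degrees by one". *)
Record skew_ext (R S : nzRingType) (F : nat -> R -> Prop) (E : nat -> S -> Prop)
    (iota : R -> S) (x : S) (sigma tau : R -> R) : Prop := SkewExt {
  ext_add : forall a b, iota (a + b) = iota a + iota b;
  ext_mul : forall a b, iota (a * b) = iota a * iota b;
  ext_filt : forall i a, F i a -> E i (iota a);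
  ext_x : E 1%N x;
  ext_sigmaK : cancel sigma tau;
  ext_tauK : cancel tau sigma;
  ext_sigma : forall i a, F i a -> F i (sigma a);
  ext_tau : forall i a, F i a -> F i (tau a);
  ext_comm : forall i a, F i a ->
    exists2 b, F i.+1 b & x * iota a = iota (sigma a) * x + iota b;
  ext_expand : forall i s, E i s -> exists2 r : nat -> R,
    forall j, F (i - j)%N (r j) & E i.+1 (s - \sum_(j < i.+1) iota (r j) * x ^+ j);
  ext_uniq : forall i (r : nat -> R),
    (forall j, (j <= i)%N -> F (i - j)%N (r j)) ->
    E i.+1 (\sum_(j < i.+1) iota (r j) * x ^+ j) ->
    forall j, (j <= i)%N -> F (i - j).+1 (r j) }.

(** * Polynomials in [x] and their weights *)

Section SkewExt.
Variables (R S : nzRingType) (F : nat -> R -> Prop) (E : nat -> S -> Prop).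
Variables (iota : R -> S) (x : S) (sigma tau : R -> R).
Hypotheses (filtF : filtration F) (filtE : filtration E).
Hypothesis extS : skew_ext F E iota x sigma tau.

Lemma ext0 : iota 0 = 0.
Proof. by apply: (addrI (iota 0)); rewrite -(ext_add extS) !addr0. Qed.

Lemma extN a : iota (- a) = - iota a.
Proof. by apply/eqP; rewrite -subr_eq0 opprK -(ext_add extS) addNr ext0. Qed.

Lemma extB a b : iota (a - b) = iota a - iota b.
Proof. by rewrite (ext_add extS) extN. Qed.

(** Left polynomials with [d] coefficients and weight at least [i], where [x] has weight one.
    Truncated subtraction leaves the coefficients from index [i] on unconstrained. *)
Definition xspan i d s := exists2 r : nat -> R,
  forall j, (j < d)%N -> F (i - j)%N (r j) & s = \sum_(j < d) iota (r j) * x ^+ j.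

Lemma xspan0 i d : xspan i d 0.
Proof.
exists (fun=> 0) => [j _|]; first exact: filt_zero.
by rewrite big1 // => j _; rewrite ext0 mul0r.
Qed.

Lemma xspanD i d s t : xspan i d s -> xspan i d t -> xspan i d (s + t).
Proof.
move=> [r Fr ->] [q Fq ->]; exists (fun j => r j + q j).
  by move=> j jd; apply: filtD => //; [apply: Fr|apply: Fq].
by rewrite -big_split; apply: eq_bigr => j _; rewrite (ext_add extS) mulrDl.
Qed.

Lemma xspanN i d s : xspan i d s -> xspan i d (- s).
Proof.
move=> [r Fr ->]; exists (fun j => - r j).
  by move=> j jd; apply: filtN => //; apply: Fr.
by rewrite -sumrN; apply: eq_bigr => j _; rewrite extN mulNr.
Qed.

Lemma xspanB i d s t : xspan i d s -> xspan i d t -> xspan i d (s - t).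
Proof. by move=> Ps Pt; apply: xspanD => //; apply: xspanN. Qed.

Lemma xspan_term i d a j : (j < d)%N -> F (i - j)%N a -> xspan i d (iota a * x ^+ j).
Proof.
move=> jd Fa; exists (fun k => if k == j then a else 0) => [k kd|].
  by case: eqP => [->|_] //; apply: filt_zero filtF _.
rewrite (bigD1 (Ordinal jd)) //= eqxx big1 ?addr0 // => k nk.
by rewrite ifF ?ext0 ?mul0r //; apply/negbTE; apply: contra nk => /eqP ?; apply/eqP/val_inj.
Qed.

Lemma xspan_sum i d I (r : seq I) (P : pred I) (f : I -> S) :
  (forall k, P k -> xspan i d (f k)) -> xspan i d (\sum_(k <- r | P k) f k).
Proof.
move=> Pf; elim/big_rec: _ => [|k s Pk Ps]; first exact: xspan0.
by apply: xspanD => //; apply: Pf.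
Qed.

Lemma xspan_leq i j c d s : (j <= i)%N -> (c <= d)%N -> xspan i c s -> xspan j d s.
Proof.
move=> ji cd [r Fr ->]; apply: xspan_sum => k _; apply: xspan_term.
  exact: leq_trans (ltn_ord k) cd.
by apply: (filt_leq filtF _ (Fr k (ltn_ord k))); apply: leq_sub2r.
Qed.

Lemma xspan_filt i d s : xspan i d s -> E i s.
Proof.
move=> [r Fr ->]; apply: filt_sum => // j _.
apply: (filt_leq filtE (j := (i - j + j)%N)); first by lia.
apply: filtM => //; first by apply: (ext_filt extS); apply: Fr.
by apply: filtX => //; apply: ext_x extS.
Qed.

Lemma xspan_mulx i d s e : xspan i d s -> xspan (i + e) (d + e) (s * x ^+ e).
Proof.
move=> [r Fr ->]; rewrite mulr_suml; apply: xspan_sum => j _.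
rewrite -mulrA -exprD; apply: xspan_term; first by rewrite ltn_add2r.
by apply: (filt_leq filtF _ (Fr j (ltn_ord j))); lia.
Qed.

Lemma xspan_iotal i d s e a : F e a -> xspan i d s -> xspan (e + i) d (iota a * s).
Proof.
move=> Fa [r Fr ->]; rewrite mulr_sumr; apply: xspan_sum => j _.
rewrite mulrA -(ext_mul extS); apply: xspan_term => //.
apply: (filt_leq filtF (j := (e + (i - j))%N)); first by lia.
by apply: filtM => //; apply: Fr.
Qed.

Lemma iter_sigma d i a : F i a -> F i (iter d sigma a).
Proof. by move=> Fa; elim: d => //= d; apply: (ext_sigma extS). Qed.

Lemma iter_tau d i a : F i a -> F i (iter d tau a).
Proof. by move=> Fa; elim: d => //= d; apply: (ext_tau extS). Qed.

Lemma iter_sigmaK d : cancel (iter d sigma) (iter d tau).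
Proof. by elim: d => // d IH a; rewrite iterSr /= (ext_sigmaK extS) IH. Qed.

Lemma iter_tauK d : cancel (iter d tau) (iter d sigma).
Proof. by elim: d => // d IH a; rewrite iterSr /= (ext_tauK extS) IH. Qed.

(** Each passage of [x] either twists the coefficient by [sigma], or loses one power of [x] and
    raises the coefficient by one degree; the weight never falls. *)
Lemma expx_iota i d a : F i a ->
  exists2 p, xspan (i + d) d p & x ^+ d * iota a = iota (iter d sigma a) * x ^+ d + p.
Proof.
move=> Fa; elim: d => [|d [p Pp eq_p]].
  by exists 0; [apply: xspan0|rewrite mul1r mulr1 addr0].
have [r Fr def_p] := Pp.
have [b Fb eq_b] := ext_comm extS (iter_sigma d Fa).
exists (iota b * x ^+ d + x * p).
  apply: xspanD; first by apply: xspan_term => //; apply: (filt_leq filtF _ Fb); lia.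
  rewrite def_p mulr_sumr; apply: xspan_sum => j _; rewrite mulrA.
  have Fj := Fr j (ltn_ord j); have [c Fc ->] := ext_comm extS Fj.
  rewrite mulrDl -mulrA -exprS; apply: xspanD; apply: xspan_term.
  - by rewrite ltnS.
  - by apply: (filt_leq filtF _ (ext_sigma extS Fj)); lia.
  - by apply: leq_trans (ltn_ord j) _.
  - by apply: (filt_leq filtF _ Fc); lia.
by rewrite exprS -mulrA eq_p mulrDr mulrA eq_b mulrDl -mulrA -exprS addrA.
Qed.

Lemma xspan_iotar i d s e a : F e a -> xspan i d s -> xspan (i + e) d (s * iota a).
Proof.
move=> Fa [r Fr ->]; rewrite mulr_suml; apply: xspan_sum => j _.
have Fj := Fr j (ltn_ord j); have [p Pp eq_p] := expx_iota j Fa.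
rewrite -mulrA eq_p mulrDr mulrA -(ext_mul extS); apply: xspanD.
  apply: xspan_term => //.
  apply: (filt_leq filtF (j := (i - j + e)%N)); first by lia.
  by apply: filtM => //; apply: iter_sigma.
apply: (@xspan_leq (i - j + (e + j)) _ j); rewrite ?(ltnW (ltn_ord j)) //; first by lia.
exact: xspan_iotal.
Qed.

(** [ext_expand] is applied to the successive remainders, each step gaining one degree. *)
Lemma ext_expand_lt N s : exists r : nat -> R, E N (s - \sum_(j < N) iota (r j) * x ^+ j).
Proof.
suff [p [r _ ->] Ep] : exists2 p, xspan 0 N p & E N (s - p) by exists r.
elim: N => [|N [p Pp Ep]]; first by exists 0; [apply: xspan0|apply: filt0].
have [r Fr Er] := ext_expand extS Ep.
exists (p + \sum_(j < N.+1) iota (r j) * x ^+ j); last by rewrite opprD addrA.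
apply: xspanD; first exact: xspan_leq Pp.
by exists r => // j _; apply: (filt_leq filtF _ (Fr j)).
Qed.

(** The coefficients gain one degree at a time: modulo [E i.+1] the sum agrees with its first [i.+1]
    terms, to which [ext_uniq] applies. *)
Lemma ext_uniq_lt N (r : nat -> R) : E N (\sum_(j < N) iota (r j) * x ^+ j) ->
  forall j, (j < N)%N -> F (N - j)%N (r j).
Proof.
move=> EN; suff H i : (i <= N)%N -> forall j, (j <= i)%N -> F (i - j)%N (r j).
  by move=> j /ltnW; apply: H.
elim: i => [_ j|i IH iN j].
  by rewrite leqn0 => /eqP->; apply: filt0.
rewrite leq_eqVlt => /predU1P[->|]; first by rewrite subnn; apply: filt0.
rewrite ltnS => ji; rewrite subSn //.
apply: (ext_uniq extS) ji => //; first exact: IH (ltnW iN).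
have -> : \sum_(j < i.+1) iota (r j) * x ^+ j = \sum_(j < N) iota (r j) * x ^+ j -
    \sum_(i.+1 <= j < N) iota (r j) * x ^+ j.
  by rewrite -!(big_mkord xpredT (fun j => iota (r j) * x ^+ j)) (big_cat_nat (leq0n _) iN) addrK.
apply: filtB => //; first exact: filt_leq EN.
rewrite big_seq; apply: filt_sum => // k; rewrite mem_index_iota => /andP[ik _].
by apply: filtMl => //; apply: (filt_leq filtE ik); apply: filtX => //; apply: ext_x extS.
Qed.

Lemma ext_lead i d a p : (d <= i)%N -> F (i - d)%N a -> xspan i d p ->
  E i.+1 (iota a * x ^+ d + p) -> F (i - d).+1 a.
Proof.
move=> di Fa [r Fr ->] Ei.
(* The coefficients of [p], completed by [a] in position [d] and padded with zeros, as [ext_uniq]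
   expects. *)
pose q j := if (j < d)%N then r j else if j == d then a else 0.
have -> : a = q d by rewrite /q ltnn eqxx.
apply: (ext_uniq extS) (di) => [j ji|].
  by rewrite /q; case: ltnP => [/Fr//|_]; case: eqP => [->|_] //; apply: filt_zero filtF _.
rewrite -(big_mkord xpredT (fun j => iota (q j) * x ^+ j)).
rewrite (big_cat_nat (n := d.+1)) //= [X in _ + X]big1_seq ?addr0 => [|j].
  rewrite big_nat_recr //= big_mkord addrC /q ltnn eqxx.
  by under eq_bigr => j _ do rewrite ltn_ord.
rewrite mem_index_iota /q => /andP[_ /andP[dj _]].
by rewrite ltnNge (ltnW dj) (gtn_eqF dj) ext0 mul0r.
Qed.

(** Right coefficients are found from the top down: [r d] becomes [iter d tau (r d)] on the right of
    [x ^+ d], and the correction joins the lower powers. *)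
Lemma xspan_right i d s : xspan i d s -> exists2 q : nat -> R,
  forall j, (j < d)%N -> F (i - j)%N (q j) & s = \sum_(j < d) x ^+ j * iota (q j).
Proof.
elim: d s => [|d IH] s [r Fr ->]; first by exists r => //; rewrite !big_ord0.
have Frd := Fr d (ltnSn d).
have [p Pp] := expx_iota d (iter_tau d Frd); rewrite iter_tauK => eq_p.
have [q Fq eq_q] : exists2 q : nat -> R, forall j, (j < d)%N -> F (i - j)%N (q j) &
    \sum_(j < d) iota (r j) * x ^+ j - p = \sum_(j < d) x ^+ j * iota (q j).
  apply: IH; apply: xspanB; first by exists r => // j jd; apply: Fr; apply: ltnW.
  by apply: xspan_leq Pp => //; lia.
exists (fun j => if j == d then iter d tau (r d) else q j) => [j|].
  rewrite ltnS leq_eqVlt => /predU1P[->|jd]; first by rewrite eqxx; apply: iter_tau.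
  by rewrite (ltn_eqF jd); apply: Fq.
rewrite !big_ord_recr /= eqxx eq_p.
under [in RHS]eq_bigr => j _ do rewrite (ltn_eqF (ltn_ord j)).
by rewrite -eq_q addrACA [- p + p]addNr addr0.
Qed.

(** Up to a power of [sigma], the top right coefficient is the top left one, where [ext_lead]
    applies; its term is then subtracted. *)
Lemma ext_uniq_right i (r : nat -> R) : (forall j, (j <= i)%N -> F (i - j)%N (r j)) ->
  E i.+1 (\sum_(j < i.+1) x ^+ j * iota (r j)) ->
  forall j, (j <= i)%N -> F (i - j).+1 (r j).
Proof.
move=> Fr; suff H d : (d <= i.+1)%N -> E i.+1 (\sum_(j < d) x ^+ j * iota (r j)) ->
    forall j, (j < d)%N -> F (i - j).+1 (r j) by move=> Er j; apply: (H i.+1).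
elim: d => // d IH di; rewrite big_ord_recr /= => Er.
have Frd := Fr d di; have [p Pp eq_p] := expx_iota d Frd.
have Fd : F (i - d).+1 (r d).
  rewrite -(iter_sigmaK d (r d)); apply: iter_tau.
  apply: (ext_lead (i := i) (p := p + \sum_(j < d) x ^+ j * iota (r j)) di (iter_sigma d Frd)).
    apply: xspanD; first by apply: xspan_leq Pp => //; lia.
    apply: xspan_sum => j _; have ji : (j <= i)%N by have := ltn_ord j; lia.
    have [t Pt ->] := expx_iota j (Fr j ji).
    apply: xspanD; first by apply: xspan_term => //; apply: iter_sigma; apply: Fr.
    by apply: xspan_leq Pt; [lia|apply: ltnW].
  by rewrite addrA -eq_p addrC.
move=> j; rewrite ltnS leq_eqVlt => /predU1P[->//|].
apply: IH; first exact: ltnW.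
rewrite -[X in E _ X](addrK (x ^+ d * iota (r d))); apply: filtB => //.
apply: (filt_leq filtE (j := (d + (i - d).+1)%N)); first by lia.
apply: filtM => //; last exact: (ext_filt extS).
by apply: filtX => //; apply: ext_x extS.
Qed.

End SkewExt.

Lemma expr_converse (S : nzRingType) (x : S) d : (x : S^c) ^+ d = x ^+ d.
Proof. by elim: d => // d IH; rewrite exprS exprSr IH. Qed.

(** The commutation rule at [tau a] reads [a x = x tau(a) - b], so [sigma] and [tau] exchange
    roles. *)
Lemma skew_ext_converse (R S : nzRingType) (F : nat -> R -> Prop) (E : nat -> S -> Prop)
    (iota : R -> S) (x : S) (sigma tau : R -> R) :
  filtration F -> filtration E -> skew_ext F E iota x sigma tau ->
  skew_ext (F : nat -> R^c -> Prop) (E : nat -> S^c -> Prop) iota x tau sigma.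
Proof.
move=> filtF filtE ext; split.
- exact: ext_add ext.
- by move=> a b; apply: ext_mul ext _ _.
- exact: ext_filt ext.
- exact: ext_x ext.
- exact: ext_tauK ext.
- exact: ext_sigmaK ext.
- exact: ext_tau ext.
- exact: ext_sigma ext.
- move=> i a Fa; have [b Fb eq_b] := ext_comm ext (ext_tau ext Fa).
  exists (- b); first exact: filtN.
  rewrite (ext_tauK ext) in eq_b.
  change (iota a * x = x * iota (tau a) + iota (- b)).
  by rewrite (extN ext) eq_b addrK.
- move=> i s Es; have [r Fr Er] := ext_expand ext Es.
  have [|q Fq eq_q] :=
    xspan_right filtF ext (i := i) (d := i.+1) (s := \sum_(j < i.+1) iota (r j) * x ^+ j).
    by exists r.
  exists (fun j => if (j <= i)%N then q j else 0) => [j|].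
    by case: ifP => [/Fq//|_]; apply: filt_zero filtF _.
  move: Er; rewrite eq_q; congr (E _ (_ - _)).
  by apply: eq_bigr => j _; rewrite expr_converse -ltnS ltn_ord.
- move=> i r Fr Er; apply: (ext_uniq_right filtF filtE ext Fr).
  by move: Er; congr (E _ _); apply: eq_bigr => j _; rewrite expr_converse.
Qed.

(** * Leading exponents *)

(** All that is retained of an iterated skew power series ring over a division ring, in a form
    stable under passing to the converse ring. *)
Inductive tower : nat -> forall S : nzRingType, (nat -> S -> Prop) -> Prop :=
| tower0 (S : nzRingType) (E : nat -> S -> Prop) :
    division_ring S -> filtration E -> (forall x, E 1%N x -> x = 0) -> tower 0 E
| towerS n (R S : nzRingType) (F : nat -> R -> Prop) (E : nat -> S -> Prop)
    (iota : R -> S) (x : S) (sigma tau : R -> R) :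
    tower n F -> filtration E -> separated E -> filt_complete E ->
    skew_ext F E iota x sigma tau -> tower n.+1 E.

Lemma tower_filt n (S : nzRingType) (E : nat -> S -> Prop) : tower n E -> filtration E.
Proof. by case. Qed.

Lemma tower_separated n (S : nzRingType) (E : nat -> S -> Prop) :
  tower n E -> separated E.
Proof. by case=> // {}S {}E _ _ E1 x /(_ 1%N) /E1. Qed.

Lemma tower_complete n (S : nzRingType) (E : nat -> S -> Prop) :
  tower n E -> filt_complete E.
Proof.
case=> // {}S {}E _ filtE E1 u cau; have [M HM] := cau 1%N.
(* As [E 1] vanishes, a sequence that is Cauchy in degree 1 is eventually constant. *)
exists (u M) => N; exists M => i Mi.
by rewrite (E1 _ (HM i M Mi (leqnn M))); apply: filt_zero.
Qed.

Lemma tower_converse n (S : nzRingType) (E : nat -> S -> Prop) :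
  tower n E -> tower n (E : nat -> S^c -> Prop).
Proof.
elim=> {n S E} [S E divS filtE E1|
    n R S F E iota x sigma tau towF IH filtE sepE compE ext].
  apply: tower0 => //; last exact: filt_converse.
  by move=> x /divS [y [xy yx]]; exists y; split.
apply: towerS IH (filt_converse filtE) _ _ _ => //.
exact: skew_ext_converse (tower_filt towF) filtE ext.
Qed.

(* [lead a f] reads "[a] is an exponent of the leading monomial of the class of
   [f] in degree [deg n a] of the associated graded ring". *)
Record lead_system n (S : nzRingType) (E : nat -> S -> Prop)
    (lead : (nat -> nat) -> S -> Prop) : Prop := LeadSystem {
  lead_ext : forall a b f, (forall s, (s < n)%N -> a s = b s) -> lead a f -> lead b f;
  lead_filt : forall a f, lead a f -> E (deg n a) f;
  lead_exists : forall i f, E i f -> ~ E i.+1 f -> exists2 a, deg n a = i & lead a f;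
  lead_mul : forall a b f, lead a f -> exp_le n a b ->
    exists2 g, E (deg n b - deg n a)%N g & lead b (f * g);
  lead_cancel : forall a f g, lead a f -> lead a g ->
    exists c, E (deg n a).+1 (f - g * c) \/
      exists b, [/\ lex_lt n b a, deg n b = deg n a & lead b (f - g * c)] }.

(** * Leading exponents in a skew extension *)

Section LeadExt.
Variables (R S : nzRingType) (F : nat -> R -> Prop) (E : nat -> S -> Prop).
Variables (iota : R -> S) (x : S) (sigma tau : R -> R).
Hypotheses (filtF : filtration F) (filtE : filtration E).
Hypothesis extS : skew_ext F E iota x sigma tau.
Variables (n : nat) (lead : (nat -> nat) -> R -> Prop).
Hypothesis leadF : lead_system n F lead.

(** The power of [x] is decided first, and its coefficient [r] supplies the other entries of the
    exponent; [p] collects the lower powers. *)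
Definition lead_x a f := exists r p, [/\ lead a r,
  xspan F iota x (deg n.+1 a) (a n) p & E (deg n.+1 a).+1 (f - (iota r * x ^+ a n + p))].

Lemma deg_upd a d : deg n.+1 (upd a n d) = (deg n a + d)%N.
Proof.
rewrite degS {2}/upd eqxx; congr (_ + _)%N; apply: deg_eq => s sn.
by rewrite /upd ltn_eqF.
Qed.

Lemma lead_upd a d r : lead a r -> lead (upd a n d) r.
Proof. by apply: (lead_ext leadF) => s sn; rewrite /upd ltn_eqF. Qed.

(** Descent on the powers of [x]: the top term is dropped if its coefficient has a higher degree
    than required, and otherwise it provides the leading exponent. *)
Lemma lead_x_exists i d f p : (d <= i.+1)%N -> xspan F iota x i d p -> E i.+1 (f - p) ->
  E i.+1 f \/ exists a, [/\ (a n < d)%N, deg n.+1 a = i & lead_x a f].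
Proof.
elim: d f p => [|d IH] f p di [r Fr ->].
  by rewrite big_ord0 subr0; left.
rewrite big_ord_recr /= => Ef.
have Pd : xspan F iota x i d (\sum_(j < d) iota (r j) * x ^+ j).
  by exists r => // j jd; apply: Fr; apply: ltnW.
have Frd := Fr d (ltnSn d).
have [Fd|nFd] := classic (F (i - d).+1 (r d)).
  have [|||] := IH f _ _ Pd; [exact: ltnW| |by left|].
    rewrite -[X in E _ X](subrK (iota (r d) * x ^+ d)); apply: filtD => //.
      by rewrite -addrA -opprD.
    apply: (filt_leq filtE (j := ((i - d).+1 + d)%N)); first by lia.
    apply: filtM => //; first exact: (ext_filt extS).
    by apply: filtX => //; apply: ext_x extS.
  by case=> a [ad deg_a la]; right; exists a; split=> //; apply: ltnW.
right; have [a deg_a la] := lead_exists leadF Frd nFd.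
exists (upd a n d); rewrite deg_upd deg_a subnK //; split=> //.
  by rewrite /upd eqxx.
exists (r d), (\sum_(j < d) iota (r j) * x ^+ j).
rewrite deg_upd deg_a subnK // {2 3}/upd eqxx; split=> //; first exact: lead_upd.
by rewrite [iota _ * _ + _]addrC.
Qed.

Lemma lead_system_ext : lead_system n.+1 E lead_x.
Proof.
split.
- move=> a b f eq_ab [r [p [lr Pp Ef]]].
  have eq_deg : deg n.+1 a = deg n.+1 b by apply: deg_eq.
  exists r, p; rewrite -eq_deg -eq_ab //; split=> //.
  by apply: (lead_ext leadF) lr => s sn; apply: eq_ab; apply: ltnW.
- move=> a f [r [p [lr Pp Ef]]]; rewrite -[f](subrK (iota r * x ^+ a n + p)).
  apply: filtD => //; first exact: filtS Ef.
  apply: filtD => //; last exact: (xspan_filt filtE extS Pp).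
  rewrite degS; apply: filtM => //; last by apply: filtX => //; apply: ext_x extS.
  by apply: (ext_filt extS); apply: (lead_filt leadF).
- move=> i f Ei nEi; have [r Fr Er] := ext_expand extS Ei.
  have [||//|[a [_ deg_a la]]] := lead_x_exists (i := i) (d := i.+1) _ _ Er; rewrite ?leqnn //.
    by exists r.
  by exists a.
- move=> a b f [r [p [lr Pp Ef]]] le_ab.
  have [|g Fg lg] := lead_mul leadF lr (b := b).
    by move=> s sn; apply: le_ab; apply: ltnW.
  have le_deg : (deg n a <= deg n b)%N.
    by apply: deg_leq => s sn; apply: le_ab; apply: ltnW.
  have le_n : (a n <= b n)%N by apply: le_ab.
  (* The twist by [tau] undoes the [sigma] that appears when [x ^+ a n] moves past the
     multiplier. *)
  have Ftg := iter_tau extS (a n) Fg.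
  have [q Pq eq_q] := expx_iota filtF extS (a n) Ftg.
  rewrite (iter_tauK extS) in eq_q.
  pose h := iota (iter (a n) tau g) * x ^+ (b n - a n).
  have Eh : E (deg n.+1 b - deg n.+1 a)%N h.
    rewrite !degS; apply: (filt_leq filtE (j := ((deg n b - deg n a) + (b n - a n))%N)).
      by lia.
    apply: filtM => //; first exact: (ext_filt extS).
    by apply: filtX => //; apply: ext_x extS.
  exists h => //.
  exists (r * g), (iota r * q * x ^+ (b n - a n) + p * h); split=> //.
    apply: (xspanD filtF extS); rewrite -{1}(subnKC le_n).
      apply: (@xspan_leq _ _ _ _ _ _ _ _ filtF extS
          (deg n a + (deg n b - deg n a + a n) + (b n - a n))%N _ (a n + (b n - a n))) => //.
        by rewrite degS; lia.
      apply: (xspan_mulx filtF extS); apply: (xspan_iotal filtF extS) => //.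
      exact: lead_filt leadF _ _ lr.
    rewrite /h mulrA; apply: (@xspan_leq _ _ _ _ _ _ _ _ filtF extS
        (deg n.+1 a + (deg n b - deg n a) + (b n - a n))%N _ (a n + (b n - a n))) => //.
      by rewrite !degS; lia.
    by apply: (xspan_mulx filtF extS); apply: (xspan_iotar filtF extS).
  have -> : f * h - (iota (r * g) * x ^+ b n + (iota r * q * x ^+ (b n - a n) + p * h)) =
      (f - (iota r * x ^+ a n + p)) * h.
    rewrite mulrBl mulrDl /h !addrA; congr (_ - (_ + _)).
    rewrite mulrA -[iota r * _ * iota _]mulrA eq_q mulrDr mulrDl.
    by rewrite (ext_mul extS) -{1}(subnKC le_n) exprD !mulrA.
  apply: (filt_leq filtE (j := ((deg n.+1 a).+1 + (deg n.+1 b - deg n.+1 a))%N)).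
    by rewrite !degS; lia.
  exact: filtM.
move=> a f g [r [p [lr Pp Ef]]] [s [q [ls Pq Eg]]].
(* The multiplier that cancels in [R] is twisted by [tau] as before; the coefficient of [x ^+ a n]
   then becomes [r - s * c], and [v] collects the lower powers. *)
have [c Hc] := lead_cancel leadF lr ls.
have [t Pt] := expx_iota filtF extS (a n) (iter_tau extS (a n) (filt0 filtF c)).
rewrite (iter_tauK extS) => eq_t.
exists (iota (iter (a n) tau c)); set h := iota _.
pose v := p - iota s * t - q * h.
have Pv : xspan F iota x (deg n.+1 a) (a n) v.
  apply: (xspanB filtF extS); first apply: (xspanB filtF extS) => //.
    rewrite degS; apply: (xspan_iotal filtF extS) => //.
    exact: lead_filt leadF _ _ ls.
  rewrite -[deg _ _]addn0; apply: (xspan_iotar filtF extS) => //.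
  by apply: iter_tau extS _ _ _ _; apply: filt0.
have Efg : E (deg n.+1 a).+1 (f - g * h - (iota (r - s * c) * x ^+ a n + v)).
  have -> : f - g * h - (iota (r - s * c) * x ^+ a n + v) =
      (f - (iota r * x ^+ a n + p)) - (g - (iota s * x ^+ a n + q)) * h.
    rewrite /v (extB extS) (ext_mul extS) !mulrBl mulrDl -[iota s * x ^+ a n * h]mulrA eq_t.
    rewrite mulrDr mulrA !opprD !opprK !addrA.
    by rewrite [LHS](ACl (1*3*5*2*4*6*7)).
  by apply: filtB => //; apply: filtMr.
(* If [r - s * c] keeps its degree, its exponent is smaller at the same power of [x]. Otherwise its
   term is negligible, and a leading exponent, if any is left in this degree, has a smaller power of
   [x]. *)
clearbody v; have {Hc} [Fc|[b [lt_ba deg_b lb]]] := Hc; last first.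
  right; exists (upd b n (a n)); rewrite deg_upd deg_b -degS; split=> //.
    right; rewrite /upd eqxx; split=> //.
    by apply: lex_lt_eq lt_ba => k kn; rewrite /upd ?(ltn_eqF kn).
  exists (r - s * c), v; rewrite deg_upd deg_b -degS {2 3}/upd eqxx; split=> //.
  exact: lead_upd.
have [||||[b [lt_ba deg_b lb]]] := @lead_x_exists (deg n.+1 a) (a n) (f - g * h) v.
- by rewrite degS; lia.
- by [].
- have -> : f - g * h - v = f - g * h - (iota (r - s * c) * x ^+ a n + v) +
      iota (r - s * c) * x ^+ a n by rewrite opprD (addrC (- (iota _ * _))) addrA subrK.
  apply: filtD => //; rewrite degS -addSn; apply: filtM => //.
    exact: (ext_filt extS).
  by apply: filtX => //; apply: ext_x extS.
- by left.
by right; exists b; split=> //; left.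
Qed.

End LeadExt.

(** * Upper bound for complete rings *)

Lemma tower_lead n (S : nzRingType) (E : nat -> S -> Prop) :
  tower n E -> exists lead, lead_system n E lead.
Proof.
elim=> {n S E} [S E divS filtE E1|
    n R S F E iota x sigma tau towF [lead leadF] filtE sepE compE ext]; last first.
  exists (lead_x F E iota x n lead).
  exact: (lead_system_ext (tower_filt towF) filtE ext leadF).
have deg0 a : deg 0 a = 0%N by rewrite /deg big_ord0.
(* Over a division ring only the empty exponent occurs, and a quotient of nonzero elements cancels
   one against the other. *)
exists (fun _ f => f <> 0); split.
- by [].
- by move=> a f _; rewrite deg0; apply: filt0.
- move=> [|i] f Ef nEf; last first.
    case: nEf; rewrite (E1 f); first exact: filt_zero.
    exact: (filt_leq filtE _ Ef).
  exists (fun=> 0%N); first exact: deg0.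
  by move=> f0; case: nEf; rewrite f0; apply: filt_zero.
- move=> a b f f0 _; exists 1; last by rewrite mulr1.
  by rewrite !deg0; apply: filt0.
move=> a f g f0 /eqP /divS [h [gh _]]; exists (h * f); left.
by rewrite mulrA gh mul1r subrr; apply: filt_zero.
Qed.

Lemma side_ideal_sum (S : nzRingType) (J : S -> Prop) I (r : seq I) (P : pred I) (f : I -> S) :
  side_ideal true J -> (forall k, P k -> J (f k)) -> J (\sum_(k <- r | P k) f k).
Proof.
by move=> [J0 JD _ _] Jf; elim/big_rec: _ => // k s Pk Js; apply: JD => //; apply: Jf.
Qed.

Lemma side_idealB (S : nzRingType) (b : bool) (J : S -> Prop) x y :
  side_ideal b J -> J x -> J y -> J (x - y).
Proof. by move=> [_ JD JN _] Jx Jy; apply: JD => //; apply: JN. Qed.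

Section CompleteUpper.
Variables (n : nat) (S : nzRingType) (E : nat -> S -> Prop).
Variable lead : (nat -> nat) -> S -> Prop.
Hypotheses (filtE : filtration E) (sepE : separated E) (compE : filt_complete E).
Hypothesis leadE : lead_system n E lead.

Definition lead_set (J : S -> Prop) a := exists2 f, J f & lead a f.

Lemma lead_set_upset J : side_ideal true J -> upset n (lead_set J).
Proof.
move=> [_ _ _ JM] a b [f Jf lf] le_ab.
have [g _ lg] := lead_mul leadE lf le_ab; exists (f * g) => //.
exact: (JM f g).
Qed.

(** The tail from index [N] lies in [E (N - d)], which adds an explicit rate to the convergence
    given by completeness. *)
Lemma cauchy_series (c : nat -> S) (d : nat) : (forall i, E (i - d)%N (c i)) ->
  exists l, forall N, E (N - d)%N (\sum_(i < N) c i - l).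
Proof.
move=> Ec.
have diff N i : (N <= i)%N -> E (N - d)%N (\sum_(k < i) c k - \sum_(k < N) c k).
  move=> Ni; rewrite -!(big_mkord xpredT c) (big_cat_nat (leq0n _) Ni) /= addrAC subrr add0r.
  rewrite big_seq; apply: filt_sum => // k; rewrite mem_index_iota => /andP[Nk _].
  by apply: (filt_leq filtE _ (Ec k)); lia.
have [|l lim] := compE (u := fun N => \sum_(i < N) c i).
  move=> N; exists (N + d)%N => i j Ni Nj.
  rewrite -(subrK (\sum_(k < (N + d)%N) c k) (\sum_(k < i) c k)) -addrA.
  rewrite -[X in E X _](addnK d); apply: filtD => //; first exact: diff.
  by rewrite -opprB; apply: filtN => //; apply: diff.
exists l => N; have [M HM] := lim (N - d)%N.
rewrite -[X in E _ (X - l)](subrK (\sum_(k < (N + M)%N) c k)) -addrA; apply: filtD => //.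
  by rewrite -opprB; apply: filtN => //; apply: diff; apply: leq_addr.
by apply: HM; apply: leq_addl.
Qed.

(* Successive approximation: finitely many elements of [I] whose leading
   exponents generate [lead_set J] already generate [J], by completeness. *)
Lemma lead_set_strict (I J : S -> Prop) : side_ideal true I -> side_ideal true J ->
  (forall x, I x -> J x) -> (forall a, lead_set J a -> lead_set I a) ->
  forall x, J x -> I x.
Proof.
move=> idI idJ IJ lJI.
have [L LI cov] := dickson (lead_set_upset idI).
have [t [f [e [If covf]]]] : exists t (f : nat -> S) (e : nat -> nat -> nat),
    (forall s, (s < t)%N -> I (f s)) /\ forall b, lead_set I b ->
      exists2 s, (s < t)%N & exp_le n (e s) b /\ lead (e s) (f s).
  have [f Hf] : exists f : (nat -> nat) -> S, forall a, lead_set I a -> I (f a) /\ lead a (f a).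
    have ch a : exists g, lead_set I a -> I g /\ lead a g.
      by have [[g Ig lg]|no] := classic (lead_set I a); [exists g|exists 0].
    exists (fun a => proj1_sig (constructive_indefinite_description _ (ch a))) => a.
    exact: proj2_sig (constructive_indefinite_description _ (ch a)).
  exists (size L), (fun s => f (nth (fun=> 0%N) L s)), (nth (fun=> 0%N) L).
  have LI' s : (s < size L)%N -> lead_set I (nth (fun=> 0%N) L s).
    move=> sL; apply: LI; elim: (L) s sL => // a L' IH [|s] /=; first by left.
    by move=> /IH; right.
  split=> [s /LI' /Hf []//|b /cov [c cL le_cb]].
  have [s sL eq_c] : exists2 s, (s < size L)%N & nth (fun=> 0%N) L s = c.
    elim: (L) cL => // a L' IH /= [->|/IH [s sL <-]]; first by exists 0%N.
    by exists s.+1.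
  by exists s => //; rewrite eq_c; split=> //; have [] := Hf c (LI c cL).
(* A uniform bound on the degrees of the generators: cofactors for an element of [E i] can be taken
   in [E (i - D)], hence tend to zero. *)
pose D := (\sum_(s < t) deg n (e s))%N.
have eD s : (s < t)%N -> (deg n (e s) <= D)%N.
  by move=> st; rewrite /D (bigD1 (Ordinal st)) //= leq_addr.
(* One step of the approximation gains one degree. The conditions on [g] stand under the existential
   so that cofactors can be chosen as functions of [i] and [g]. *)
have step i g : exists c : nat -> S, J g -> E i g ->
    (forall s, E (i - D)%N (c s)) /\ E i.+1 (g - \sum_(s < t) f s * c s).
  have [[Jg Eg]|no] := classic (J g /\ E i g); last first.
    by exists (fun=> 0) => Jg Eg; case: no.
  suff [c [Ec Egc]] : exists c : nat -> S, (forall s, E (i - D)%N (c s)) /\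
      E i.+1 (g - \sum_(s < t) f s * c s) by exists c.
  have zero h : E i.+1 h -> exists c : nat -> S, (forall s, E (i - D)%N (c s)) /\
      E i.+1 (h - \sum_(s < t) f s * c s).
    move=> Eh; exists (fun=> 0); split=> [s|]; first exact: filt_zero.
    by rewrite big1 ?subr0 // => s _; rewrite mulr0.
  have [/zero//|nEg] := classic (E i.+1 g).
  have [b deg_b lb] := lead_exists leadE Eg nEg.
  (* Inside degree [i] the leading exponent is lowered lexicographically until the degree rises. *)
  elim: b / (lex_lt_wf n b) g Jg deg_b lb {Eg nEg} => b _ IH g Jg deg_b lb.
  have [s st [le_b ls]] := covf b (lJI b (ex_intro2 _ _ g Jg lb)).
  have [h Eh lh] := lead_mul leadE ls le_b.
  have [c Hc] := lead_cancel leadE lb lh.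
  have Jg' : J (g - f s * h * c).
    apply: (side_idealB idJ Jg); rewrite -mulrA.
    by have [_ _ _ JM] := idJ; apply: (JM (f s)); apply: IJ; apply: If.
  have [d [Ed Egd]] : exists d : nat -> S, (forall s, E (i - D)%N (d s)) /\
      E i.+1 (g - f s * h * c - \sum_(s < t) f s * d s).
    case: Hc => [|[b' [lt_b deg_b' lb']]]; first by rewrite deg_b => /zero.
    by apply: IH lt_b _ Jg' _ lb'; rewrite deg_b'.
  exists (fun u => if u == s then h * c + d s else d u); split=> [u|].
    case: eqP => _ //; apply: filtD => //; apply: filtMr => //.
    by apply: (filt_leq filtE _ Eh); rewrite deg_b; apply: leq_sub2l; apply: eD.
  move: Egd; rewrite -addrA -opprD; congr (E _ (_ - _)).
  rewrite (bigD1 (Ordinal st)) //= [in RHS](bigD1 (Ordinal st)) //= eqxx mulrDr addrA mulrA.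
  congr (_ + _); apply: eq_bigr => u nu; rewrite ifF //.
  by apply/negbTE; apply: contra nu => /eqP ?; apply/eqP/val_inj.
have {}step : exists C : nat -> S -> nat -> S, forall i g, J g -> E i g ->
    (forall s, E (i - D)%N (C i g s)) /\ E i.+1 (g - \sum_(s < t) f s * C i g s).
  exists (fun i g => proj1_sig (constructive_indefinite_description _ (step i g))).
  by move=> i g; exact: proj2_sig (constructive_indefinite_description _ (step i g)).
have [C HC] := step => x Jx.
pose fix rest i := if i is j.+1 then rest j - \sum_(s < t) f s * C j (rest j) s else x.
have Hrest i : J (rest i) /\ E i (rest i).
  elim: i => [|i [Jr Er]]; first by split=> //; apply: filt0.
  have [_ Er'] := HC i _ Jr Er; split=> //=.
  apply: (side_idealB idJ Jr); apply: side_ideal_sum => // s _.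
  by have [_ _ _ JM] := idJ; apply: (JM (f s)); apply: IJ; apply: If.
have EC i s : E (i - D)%N (C i (rest i) s) by have [Jr Er] := Hrest i; case: (HC i _ Jr Er).
have limC s : exists l, forall N, E (N - D)%N (\sum_(i < N) C i (rest i) s - l).
  by apply: (cauchy_series (c := fun i => C i (rest i) s)) => i; apply: EC.
pose l s := proj1_sig (constructive_indefinite_description _ (limC s)).
have Hl s : forall N, E (N - D)%N (\sum_(i < N) C i (rest i) s - l s).
  exact: proj2_sig (constructive_indefinite_description _ (limC s)).
suff -> : x = \sum_(s < t) f s * l s.
  apply: side_ideal_sum => // s _.
  by have [_ _ _ IM] := idI; apply: (IM (f s) (l s)); apply: If.
(* After [N + D] steps both the remainder and the errors on the limits of the cofactors lie in
   [E N]. *)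
apply/eqP; rewrite -subr_eq0; apply/eqP/sepE => N.
have -> : x = rest (N + D)%N + \sum_(s < t) f s * \sum_(i < (N + D)%N) C i (rest i) s.
  elim: (N + D)%N => [|i IH] /=.
    by rewrite big1 ?addr0 // => s _; rewrite big_ord0 mulr0.
  rewrite [LHS]IH -addrA; congr (_ + _).
  rewrite addrC -sumrB; apply: eq_bigr => s _.
  by rewrite big_ord_recr /= mulrDr addrK.
rewrite -addrA; apply: filtD => //.
  by apply: (filt_leq filtE (leq_addr D N)); case: (Hrest (N + D)%N).
rewrite -sumrB; apply: filt_sum => // s _; rewrite -mulrBr.
by apply: filtMl => //; rewrite -{1}(addnK D N).
Qed.

Lemma devlt_complete : devlt true n.+1 (fun x : S => x = 0) (fun=> True).
Proof.
apply: (devlt_exponents (ini := lead_set)) => //.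
- exact: lead_set_upset.
- by move=> I J IJ a [f /IJ Jf lf]; exists f.
- exact: lead_set_strict.
split=> //= [x y -> ->|x ->|x r ->]; [exact: addr0|exact: oppr0|exact: mul0r].
Qed.

End CompleteUpper.

(** * Graded rings and the upper bound for gr(S) *)

(** The data of [assoc_graded], for an arbitrary filtration. *)
Record graded_of (S G : nzRingType) (E : nat -> S -> Prop) (phi : nat -> S -> G) : Prop :=
  GradedOf {
  grD : forall i a b, E i a -> E i b -> phi i (a + b) = phi i a + phi i b;
  gr_eq0 : forall i a, E i a -> (phi i a = 0 <-> E i.+1 a);
  grM : forall i j a b, E i a -> E j b -> phi i a * phi j b = phi (i + j)%N (a * b);
  gr_gen : forall g : G, exists (N : nat) (a : nat -> S),
    (forall i, E i (a i)) /\ g = \sum_(i < N) phi i (a i);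
  gr_direct : forall (N : nat) (a : nat -> S), (forall i, E i (a i)) ->
    \sum_(i < N) phi i (a i) = 0 -> forall i, (i < N)%N -> phi i (a i) = 0 }.

Lemma graded_converse (S G : nzRingType) (E : nat -> S -> Prop) (phi : nat -> S -> G) :
  graded_of E phi -> graded_of (E : nat -> S^c -> Prop) (phi : nat -> S^c -> G^c).
Proof.
case=> D z M gen dir; split=> // i j a b Ea Eb.
by rewrite addnC; apply: M Eb Ea.
Qed.

Section Graded.
Variables (S G : nzRingType) (E : nat -> S -> Prop) (phi : nat -> S -> G).
Hypotheses (filtE : filtration E) (grG : graded_of E phi).

Lemma gr0 i : phi i 0 = 0.
Proof. by apply/(gr_eq0 grG); apply: filt_zero. Qed.

Lemma grN i a : E i a -> phi i (- a) = - phi i a.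
Proof.
move=> Ea; apply/eqP; rewrite -subr_eq0 opprK -(grD grG) //; last exact: filtN.
by rewrite addNr gr0.
Qed.

Lemma grB i a b : E i a -> E i b -> phi i (a - b) = phi i a - phi i b.
Proof. by move=> Ea Eb; rewrite (grD grG) // ?grN //; apply: filtN. Qed.

(** For [J] all of [S] this is the part of [G] in degrees below [i]. *)
Definition gr_span (J : S -> Prop) i g := exists2 a : nat -> S,
  forall j, J (a j) /\ E j (a j) & g = \sum_(j < i) phi j (a j).

Section Span.
Variable J : S -> Prop.
Hypothesis idJ : side_ideal true J.

Lemma gr_span0 i : gr_span J i 0.
Proof.
exists (fun=> 0) => [j|]; last by rewrite big1 // => j _; rewrite gr0.
by split; [case: idJ|apply: filt_zero].
Qed.

Lemma gr_spanD i g h : gr_span J i g -> gr_span J i h -> gr_span J i (g + h).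
Proof.
move=> [a Ja ->] [b Jb ->]; exists (fun j => a j + b j) => [j|].
  have [[Jaj Eaj] [Jbj Ebj]] := (Ja j, Jb j).
  by split; [case: idJ => _ JD _ _; apply: JD|apply: filtD].
rewrite -big_split; apply: eq_bigr => j _; rewrite (grD grG) //.
  by case: (Ja j).
by case: (Jb j).
Qed.

Lemma gr_spanN i g : gr_span J i g -> gr_span J i (- g).
Proof.
move=> [a Ja ->]; exists (fun j => - a j) => [j|].
  have [Jaj Eaj] := Ja j; split; last exact: filtN.
  by case: idJ => _ _ JN _; apply: JN.
by rewrite -sumrN; apply: eq_bigr => j _; rewrite grN //; case: (Ja j).
Qed.

Lemma gr_spanB i g h : gr_span J i g -> gr_span J i h -> gr_span J i (g - h).
Proof. by move=> Pg Ph; apply: gr_spanD => //; apply: gr_spanN. Qed.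

Lemma gr_span_term i j a : (j < i)%N -> J a -> E j a -> gr_span J i (phi j a).
Proof.
move=> ji Ja Ea; have J0 : J 0 by case: idJ.
exists (fun k => if k == j then a else 0) => [k|].
  by case: eqP => [->//|_]; split=> //; apply: filt_zero.
rewrite (bigD1 (Ordinal ji)) //= eqxx big1 ?addr0 // => k nk.
by rewrite ifF ?gr0 //; apply/negbTE; apply: contra nk => /eqP ?; apply/eqP/val_inj.
Qed.

Lemma gr_span_sum i I (r : seq I) (P : pred I) (f : I -> G) :
  (forall k, P k -> gr_span J i (f k)) -> gr_span J i (\sum_(k <- r | P k) f k).
Proof.
move=> Pf; elim/big_rec: _ => [|k s Pk Ps]; first exact: gr_span0.
by apply: gr_spanD => //; apply: Pf.
Qed.

Lemma gr_span_leq i j g : (i <= j)%N -> gr_span J i g -> gr_span J j g.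
Proof.
move=> ij [a Ja ->]; apply: gr_span_sum => k _; case: (Ja k) => Jak Eak.
by apply: gr_span_term => //; apply: leq_trans ij.
Qed.

Lemma gr_spanM i e g h : E e h -> gr_span J i g -> gr_span J (i + e) (g * phi e h).
Proof.
move=> Eh [a Ja ->]; rewrite mulr_suml; apply: gr_span_sum => j _.
have [Jaj Eaj] := Ja j; rewrite (grM grG) //; apply: gr_span_term.
- by rewrite ltn_add2r.
- by case: idJ => _ _ _ JM; apply: (JM (a j)).
- exact: filtM.
Qed.

Definition gr_ideal g := exists i, gr_span J i g.

Lemma gr_side_ideal : side_ideal true gr_ideal.
Proof.
split.
- by exists 0%N; apply: gr_span0.
- move=> g h [i Pg] [j Ph]; exists (i + j)%N.
  by apply: gr_spanD; [apply: gr_span_leq Pg|apply: gr_span_leq Ph];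
    rewrite ?leq_addr ?leq_addl.
- by move=> g [i Pg]; exists i; apply: gr_spanN.
move=> g h [i Pg] /=; have [N [b [Eb ->]]] := gr_gen grG h.
exists (i + N)%N; rewrite mulr_sumr; apply: gr_span_sum => j _.
by apply: gr_span_leq (gr_spanM (Eb j) Pg); rewrite leq_add2l ltnW.
Qed.

End Span.

Section GradedUpper.
Variables (n : nat) (lead : (nat -> nat) -> S -> Prop).
Hypothesis leadE : lead_system n E lead.

Notation low := (gr_span (fun=> True)).

(** Elements of [J] need not be homogeneous: the exponent is read off the component of highest
    degree, the other components being absorbed in [low]. *)
Definition gr_lead_set (J : G -> Prop) a :=
  exists g f, [/\ J g, lead a f & low (deg n a) (g - phi (deg n a) f)].

Lemma side_ideal_full : side_ideal true (fun _ : S => True).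
Proof. by split. Qed.
Let idT := side_ideal_full.

Lemma gr_lead_set_upset J : side_ideal true J -> upset n (gr_lead_set J).
Proof.
move=> [_ _ _ JM] a b [g [f [Jg lf lowg]]] le_ab.
have [h Eh lh] := lead_mul leadE lf le_ab.
exists (g * phi (deg n b - deg n a)%N h), (f * h); split=> //; first exact: (JM g).
have := gr_spanM idT Eh lowg; rewrite subnKC ?deg_leq // mulrBl (grM grG) //.
  by rewrite subnKC // deg_leq.
exact: (lead_filt leadE).
Qed.

(** Subtracting multiples of elements of [I] lowers the leading exponent of the top component, and
    eventually removes that component; an outer induction on the degree finishes. *)
Lemma gr_lead_set_strict (I J : G -> Prop) : side_ideal true I -> side_ideal true J ->
  (forall x, I x -> J x) -> (forall a, gr_lead_set J a -> gr_lead_set I a) ->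
  forall x, J x -> I x.
Proof.
move=> idI idJ IJ lJI x Jx; have [N [c [Ec eq_x]]] := gr_gen grG x.
have : low N x by exists c.
elim: N x Jx {c Ec eq_x} => [|i IH] g Jg [a Ea eq_g].
  by rewrite eq_g big_ord0; case: idI.
have Eai : E i (a i) by case: (Ea i).
have lowg : low i (g - phi i (a i)) by exists a => //; rewrite eq_g big_ord_recr addrK.
have zero h f : J h -> E i.+1 f -> low i (h - phi i f) -> I h.
  move=> Jh Ef; have -> : phi i f = 0 by apply/(gr_eq0 grG) => //; apply: filtS Ef.
  by rewrite subr0; apply: IH.
have [/zero|nE] := classic (E i.+1 (a i)); first exact.
have [b deg_b lb] := lead_exists leadE Eai nE.
elim: b / (lex_lt_wf n b) g (a i) Jg deg_b lb lowg {Eai nE eq_g Ea}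
  => b _ IHb g f Jg deg_b lb lowg.
have Ef : E i f by rewrite -deg_b; apply: lead_filt leadE _ _ lb.
have [|g' [f' []]] := lJI b; first by exists g, f; rewrite deg_b.
rewrite deg_b => Ig' lb' lowg'.
have Ef' : E i f' by rewrite -deg_b; apply: lead_filt leadE _ _ lb'.
have [c Hc] := lead_cancel leadE lb lb'.
(* [f] and [f'] have the same degree, so the multiplier is placed in degree 0. *)
have Ig'c : I (g' * phi 0%N c) by case: idI => _ _ _ IM; apply: (IM g').
have Jg'' : J (g - g' * phi 0%N c) by apply: side_idealB idJ Jg _; apply: IJ.
have E0c : E 0%N c by apply: filt0.
have lowg'' : low i (g - g' * phi 0%N c - phi i (f - f' * c)).
  have := gr_spanM idT E0c lowg'; rewrite mulrBl (grM grG) // !addn0 => lowg'c.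
  have := gr_spanB idT lowg lowg'c; rewrite [phi i (f - _)]grB //; last exact: filtMr.
  by congr (gr_span _ _ _); rewrite !opprB !addrA [LHS](ACl (1*4*2*3)) addrAC.
have Ig'' : I (g - g' * phi 0%N c).
  case: Hc => [|[b' [lt_b deg_b' lb2]]].
    by rewrite deg_b => /zero; apply.
  by apply: IHb lt_b _ _ Jg'' _ lb2 lowg''; rewrite deg_b'.
by rewrite -(subrK (g' * phi 0%N c) g); case: idI => _ ID _ _; apply: ID.
Qed.

Lemma devlt_graded : devlt true n.+1 (fun x : G => x = 0) (fun=> True).
Proof.
apply: (devlt_exponents (ini := gr_lead_set)) => //.
- exact: gr_lead_set_upset.
- by move=> I J IJ a [g [f [/IJ Jg lf lg]]]; exists g, f.
- exact: gr_lead_set_strict.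
by split=> //= [x y -> ->|x ->|x r ->]; [exact: addr0|exact: oppr0|exact: mul0r].
Qed.

End GradedUpper.
End Graded.

(** * Chains of closed right ideals *)

Definition filt_closed (S : nzRingType) (E : nat -> S -> Prop) (A : S -> Prop) :=
  forall x, (forall N, exists2 a, A a & E N (x - a)) -> A x.

(* Passing to associated graded ideals, or to power series ideals, is strictly
   monotone on closed right ideals only. *)
Fixpoint devcl (S : nzRingType) (E : nat -> S -> Prop) n (A B : S -> Prop) : Prop :=
  match n with
  | 0 => forall x, B x -> A x
  | p.+1 => forall c : nat -> S -> Prop,
      (forall i, side_ideal true (c i) /\ filt_closed E (c i)) ->
      (forall i x, A x -> c i x) -> (forall i x, c i x -> B x) ->
      (forall i x, c i.+1 x -> c i x) ->
      exists N, forall i, (N <= i)%N -> devcl E p (c i.+1) (c i)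
  end.

Lemma devlt_devcl (S : nzRingType) (E : nat -> S -> Prop) n (A B : S -> Prop) :
  devlt true n A B -> devcl E n A B.
Proof.
elim: n A B => //= n IH A B dAB c idc Ac cB desc.
have [|N HN] := dAB c _ Ac cB desc; first by move=> i; case: (idc i).
by exists N => i /HN; apply: IH.
Qed.

Lemma devcl_mono (S : nzRingType) (E : nat -> S -> Prop) n (A A' B B' : S -> Prop) :
  (forall x, A x -> A' x) -> (forall x, B' x -> B x) -> devcl E n A B -> devcl E n A' B'.
Proof.
case: n => [|n] /= AA' BB' dAB; first by move=> x /BB' /dAB /AA'.
move=> c idc Ac cB; apply: dAB => // i x; first by move/AA'; apply: Ac.
by move/cB/BB'.
Qed.

(** * Lower bounds *)

Section ExtendedIdeal.
Variables (R S : nzRingType) (F : nat -> R -> Prop) (E : nat -> S -> Prop).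
Variables (iota : R -> S) (x : S) (sigma tau : R -> R).
Hypotheses (filtF : filtration F) (filtE : filtration E).
Hypothesis extS : skew_ext F E iota x sigma tau.

(** The closure of the polynomials with left coefficients in [A], which plays the part of A[[x]];
    the coefficients may depend on the precision [N]. *)
Definition hat (A : R -> Prop) s := forall N, exists2 a : nat -> R,
  forall j, A (a j) & E N (s - \sum_(j < N) iota (a j) * x ^+ j).

Lemma hat_mono (A B : R -> Prop) : (forall a, A a -> B a) -> forall s, hat A s -> hat B s.
Proof. by move=> AB s hs N; have [a /(_ _)/AB Ba Es] := hs N; exists a => // j; apply: Ba. Qed.

Section HatIdeal.
Variable A : R -> Prop.
Hypothesis idA : side_ideal true A.

Lemma hat_closed : filt_closed E (hat A).
Proof.
move=> s cls N; have [t ht Est] := cls N; have [a Aa Et] := ht N; exists a => //.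
by rewrite -(subrK t s) -addrA; apply: filtD.
Qed.

Lemma hat0 : hat A 0.
Proof.
move=> N; exists (fun=> 0) => [j|]; first by case: idA.
by rewrite big1 ?subr0 ?(filt_zero filtE) // => [|j _];
  [apply: filt_zero|rewrite (ext0 extS) mul0r].
Qed.

Lemma hatD s t : hat A s -> hat A t -> hat A (s + t).
Proof.
move=> hs ht N; have [a Aa Es] := hs N; have [b Ab Et] := ht N.
exists (fun j => a j + b j) => [j|]; first by case: idA => _ AD _ _; apply: AD.
have -> : \sum_(j < N) iota (a j + b j) * x ^+ j =
    \sum_(j < N) iota (a j) * x ^+ j + \sum_(j < N) iota (b j) * x ^+ j.
  by rewrite -big_split; apply: eq_bigr => j _; rewrite (ext_add extS) mulrDl.
by rewrite opprD addrACA; apply: filtD.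
Qed.

Lemma hatN s : hat A s -> hat A (- s).
Proof.
move=> hs N; have [a Aa Es] := hs N.
exists (fun j => - a j) => [j|]; first by case: idA => _ _ AN _; apply: AN.
have -> : \sum_(j < N) iota (- a j) * x ^+ j = - \sum_(j < N) iota (a j) * x ^+ j.
  by rewrite -sumrN; apply: eq_bigr => j _; rewrite (extN extS) mulNr.
by rewrite -opprD; apply: filtN.
Qed.

Lemma hat_sum I (r : seq I) (P : pred I) (f : I -> S) :
  (forall k, P k -> hat A (f k)) -> hat A (\sum_(k <- r | P k) f k).
Proof.
move=> hf; elim/big_rec: _ => [|k s Pk hs]; first exact: hat0.
by apply: hatD => //; apply: hf.
Qed.

Lemma hat_term a k : A a -> hat A (iota a * x ^+ k).
Proof.
move=> Aa N; have A0 : A 0 by case: idA.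
exists (fun j => if j == k then a else 0) => [j|]; first by case: eqP.
have [kN|Nk] := ltnP k N.
  rewrite (bigD1 (Ordinal kN)) //= eqxx big1 ?addr0 ?subrr; first exact: filt_zero.
  move=> j nj; rewrite ifF ?(ext0 extS) ?mul0r //.
  by apply/negbTE; apply: contra nj => /eqP ?; apply/eqP/val_inj.
rewrite big1 ?subr0.
  apply: filtMl => //; apply: (filt_leq filtE Nk).
  by apply: filtX => //; apply: ext_x extS.
by move=> j _; rewrite ifF ?(ext0 extS) ?mul0r //; have := ltn_ord j; lia.
Qed.

(** By closedness only products of polynomials matter; moving powers of [x] to the right multiplies
    the coefficients from [A] on their right. *)
Lemma hat_side_ideal : side_ideal true (hat A).
Proof.
split; [exact: hat0|exact: hatD|exact: hatN|] => s t hs /=.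
apply: hat_closed => N; have [a Aa Es] := hs N.
have [r Er] := ext_expand_lt filtF filtE extS N t.
exists ((\sum_(j < N) iota (a j) * x ^+ j) * (\sum_(l < N) iota (r l) * x ^+ l)).
  rewrite mulr_suml; apply: hat_sum => j _; rewrite mulr_sumr; apply: hat_sum => l _.
  have [p [q Fq ->] eq_p] := expx_iota filtF extS j (filt0 filtF (r l)).
  have AM b c : A b -> A (b * c) by case: idA => _ _ _ AM; apply: (AM b c).
  rewrite -mulrA [_ * (iota (r l) * _)]mulrA eq_p mulrDl mulrDr -mulrA -exprD.
  apply: hatD; first by rewrite mulrA -(ext_mul extS); apply: hat_term; apply: AM.
  rewrite mulr_suml mulr_sumr; apply: hat_sum => k _.
  by rewrite -mulrA -exprD mulrA -(ext_mul extS); apply: hat_term; apply: AM.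
set u := \sum_(j < N) _ in Es *; set v := \sum_(l < N) _ in Er *.
have -> : s * t - u * v = (s - u) * t + u * (t - v).
  by rewrite mulrBl mulrBr addrA subrK.
by apply: filtD => //; [apply: filtMr|apply: filtMl].
Qed.

End HatIdeal.

(* If [b] is in [B] but not in [A], the elements [b x^i] separate infinitely many
   terms of the chain of the ideals [hat A + (hat B /\ E j)]. *)
Lemma devcl_hat1 (A B : R -> Prop) : side_ideal true A -> side_ideal true B ->
  filt_closed F A -> (forall a, A a -> B a) ->
  devcl E 1 (hat A) (hat B) -> forall b, B b -> A b.
Proof.
move=> idA idB clA AB dAB b Bb; apply: clA => N; apply: NNPP => nb.
have [idhA idhB] := (hat_side_ideal idA, hat_side_ideal idB).
pose c j s := hat B s /\ exists2 a, hat A a & E j (s - a).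
have [|i s As|i s []//|i s [Bs [a Aa Ea]]|M HM] := dAB c.
- move=> i; split; last first.
    move=> s cls; split.
      by apply: hat_closed => n; have [t [Bt _] Et] := cls n; exists t.
    have [t [_ [a Aa Ea]] Et] := cls i; exists a => //.
    by rewrite -(subrK t s) -addrA; apply: filtD.
  have [A0 AD AN AM] := idhA; have [B0 BD BN BM] := idhB; split.
  - by split=> //; exists 0; rewrite ?subrr //; apply: filt_zero.
  - move=> s t [Bs [a Aa Ea]] [Bt [a' Aa' Ea']]; split; first exact: BD.
    by exists (a + a'); [apply: AD|rewrite opprD addrACA; apply: filtD].
  - move=> s [Bs [a Aa Ea]]; split; first exact: BN.
    by exists (- a); [apply: AN|rewrite -opprD; apply: filtN].
  - move=> s t [Bs [a Aa Ea]]; split; first exact: BM.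
    by exists (a * t); [apply: AM|rewrite -mulrBl; apply: filtMr].
- split; first exact: hat_mono As.
  by exists s => //; rewrite subrr; apply: filt_zero.
- by split=> //; exists a => //; apply: filtS Ea.
have {}HM k : c M (iota b * x ^+ M) -> c (M + k)%N (iota b * x ^+ M).
  by move=> cM; elim: k => [|k IH]; rewrite ?addn0 ?addnS //; apply: HM (leq_addr _ _) _ IH.
(* Since the chain is stationary from [M], the element [iota b * x ^+ M] lies in [c (M + N.+1)];
   comparing coefficients of [x ^+ M] puts [b - a M] in [F N.+1]. *)
have [|_ [s /(_ (M + N.+1)%N) [a Aa Ea] Es]] := HM N.+1.
  split; first exact: hat_term.
  exists 0; first exact: hat0.
  by rewrite subr0; apply: filtMl => //; apply: filtX => //; apply: ext_x extS.
apply: nb; exists (a M) => //.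
have lt_M : (M < M + N.+1)%N by lia.
have := @ext_uniq_lt _ _ _ _ _ _ _ _ filtF filtE extS (M + N.+1)
  (fun j => if j == M then b - a M else - a j) _ M lt_M.
rewrite eqxx; have -> : (M + N.+1 - M)%N = N.+1 by lia.
move=> H; apply: (filtS filtF); apply: H.
have -> : \sum_(j < M + N.+1) iota (if j == M :> nat then b - a M else - a j) * x ^+ j =
    iota b * x ^+ M - \sum_(j < M + N.+1) iota (a j) * x ^+ j.
  rewrite (bigD1 (Ordinal lt_M)) //= eqxx (extB extS) mulrBl.
  rewrite [in RHS](bigD1 (Ordinal lt_M)) //= opprD addrA -sumrN; congr (_ + _).
  apply: eq_bigr => j nj; rewrite ifF ?(extN extS) ?mulNr //.
  by apply/negbTE; apply: contra nj => /eqP ?; apply/eqP/val_inj.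
by rewrite -(subrK s (iota b * _)) -addrA; apply: filtD.
Qed.

(** [hat] sends chains of closed right ideals to such chains; the extra unit of deviation comes from
    [devcl_hat1] at the bottom of the induction. *)
Lemma devcl_hat p (A B : R -> Prop) : side_ideal true A -> side_ideal true B ->
  filt_closed F A -> (forall a, A a -> B a) ->
  devcl E p.+1 (hat A) (hat B) -> devcl F p A B.
Proof.
elim: p A B => [|p IH] A B idA idB clA AB dAB; first exact: devcl_hat1 dAB.
move=> c idc Ac cB desc.
have [i|i|i|i|N HN] := dAB (fun i => hat (c i)).
- have [idci _] := idc i; split; [exact: hat_side_ideal|exact: hat_closed].
- by apply: hat_mono; apply: Ac.
- by apply: hat_mono; apply: cB.
- by apply: hat_mono; apply: desc.
exists N => i Ni; have [[idi cli] [idi' cli']] := (idc i, idc i.+1).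
by apply: IH => //; [apply: desc|apply: HN].
Qed.

End ExtendedIdeal.

Lemma side_ideal_zero (S : nzRingType) (b : bool) : side_ideal b (fun x : S => x = 0).
Proof.
split=> //= [x y -> ->|x ->|x r ->]; [exact: addr0|exact: oppr0|].
by case: b; rewrite ?mul0r ?mulr0.
Qed.

Lemma filt_closed_zero (S : nzRingType) (E : nat -> S -> Prop) :
  separated E -> filt_closed E (fun x => x = 0).
Proof. by move=> sepE x clx; apply: sepE => N; have [a -> ] := clx N; rewrite subr0. Qed.

Lemma tower_devcl n (S : nzRingType) (E : nat -> S -> Prop) :
  tower n E -> ~ devcl E n (fun x => x = 0) (fun=> True).
Proof.
elim=> {n S E} [S E _ _ _ /(_ 1 I)/eqP|n R S F E iota x sigma tau towF IH filtE sepE _ ext dE].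
  by rewrite oner_eq0.
have [filtF sepF] := (tower_filt towF, tower_separated towF).
apply: IH; apply: (devcl_hat filtF filtE ext) => //; try exact: side_ideal_zero.
  exact: filt_closed_zero.
apply: devcl_mono dE => [s ->|//]; exact: hat0 filtE ext _ (side_ideal_zero _ _).
Qed.

(** * Transfer of the lower bound to the graded ring *)

Section GradedLower.
Variables (S G : nzRingType) (E : nat -> S -> Prop) (phi : nat -> S -> G).
Hypotheses (filtE : filtration E) (grG : graded_of E phi).

(** At [p = 0], an element of [B] is approximated degree by degree by elements of [A] with the same
    symbols, and closedness of [A] concludes. Longer chains are carried over term by term. *)
Lemma devlt_gr p (A B : S -> Prop) : side_ideal true A -> side_ideal true B ->
  filt_closed E A -> (forall s, A s -> B s) ->
  devlt true p (gr_ideal E phi A) (gr_ideal E phi B) -> devcl E p A B.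
Proof.
have mono (I J : S -> Prop) : (forall s, I s -> J s) ->
    forall g, gr_ideal E phi I g -> gr_ideal E phi J g.
  move=> IJ g [i [a Ia ->]]; exists i, a => // j.
  by case: (Ia j) => Iaj Eaj; split=> //; apply: IJ.
elim: p A B => [|p IH] A B idA idB clA AB dAB.
  move=> b Bb; apply: clA; elim=> [|N [a Aa Ea]].
    by exists 0; [case: idA|apply: filt0].
  have Bba : B (b - a) by apply: side_idealB idB Bb _; apply: AB.
  (* The sum is lengthened so that index [N] certainly occurs in it. *)
  have [M [c Ac eq_c]] : exists M, gr_span E phi A (M + N.+1) (phi N (b - a)).
    have [|M PM] := dAB (phi N (b - a)); first by exists N.+1; apply: gr_span_term.
    by exists M; apply: gr_span_leq PM => //; apply: leq_addr.
  have Ec j : E j (c j) by case: (Ac j).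
  have lt_N : (N < M + N.+1)%N by lia.
  exists (a + c N).
    by case: idA => _ AD _ _; apply: AD => //; case: (Ac N).
  (* With the symbol of [b - a] moved into component [N] the sum vanishes, and directness kills that
     component. *)
  pose d j := if j == N then c N - (b - a) else c j.
  have Ed j : E j (d j) by rewrite /d; case: eqP => [->|//]; apply: filtB.
  have : phi N (d N) = 0.
    apply: (gr_direct grG Ed) (lt_N).
    rewrite (bigD1 (Ordinal lt_N)) //= /d eqxx (grB filtE grG) // eq_c (bigD1 (Ordinal lt_N)) //=.
    rewrite opprD addNKr addrC -sumrB big1 // => j nj.
    rewrite ifF ?subrr //.
    by apply/negbTE; apply: contra nj => /eqP ?; apply/eqP/val_inj.
  move/(gr_eq0 grG (Ed N)); rewrite /d eqxx => EN.
  by rewrite opprD addrA -opprB; apply: filtN.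
move=> c idc Ac cB desc.
have [i|i|i|i|N HN] := dAB (fun i => gr_ideal E phi (c i)).
- by apply: gr_side_ideal => //; case: (idc i).
- by apply: mono; apply: Ac.
- by apply: mono; apply: cB.
- by apply: mono; apply: desc.
exists N => i Ni; have [[idi cli] [idi' cli']] := (idc i, idc i.+1).
by apply: IH => //; [apply: desc|apply: HN].
Qed.

Lemma gr_full g : gr_ideal E phi (fun=> True) g.
Proof. by have [N [a [Ea ->]]] := gr_gen grG g; exists N, a. Qed.

Lemma gr_zero g : gr_ideal E phi (fun s => s = 0) g -> g = 0.
Proof.
move=> [N [a a0 ->]]; rewrite big1 // => j _.
by case: (a0 j) => -> _; apply: gr0 filtE grG _.
Qed.

End GradedLower.

(** * Skew power series rings as filtered skew extensions *)

Section IdealPowers.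
Variables (R : nzRingType) (m : R -> Prop).
Hypothesis idm : ideal m.

Lemma ideal_pow_zero i : ideal_pow m i 0.
Proof.
elim: i => // i IH; exists 0%N, (fun=> 0), (fun=> 0).
by split=> [_|]; [split=> //; case: idm|rewrite big_ord0].
Qed.

Lemma ideal_powD i x y : ideal_pow m i x -> ideal_pow m i y -> ideal_pow m i (x + y).
Proof.
case: i => // i [M [a [b [ab ->]]]] [N [c [d [cd ->]]]].
exists (M + N)%N, (fun k => if (k < M)%N then a k else c (k - M)%N),
  (fun k => if (k < M)%N then b k else d (k - M)%N).
split=> [k|]; first by case: ifP.
rewrite big_split_ord /=; congr (_ + _); apply: eq_bigr => k _.
  by rewrite ltn_ord.
by rewrite ltnNge leq_addr /= addKn.
Qed.

Lemma ideal_powN i x : ideal_pow m i x -> ideal_pow m i (- x).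
Proof.
case: i => // i [M [a [b [ab ->]]]]; exists M, a, (fun k => - b k); split=> [k|].
  by have [Fa mb] := ab k; split=> //; case: idm => _ _ mN _ _; apply: mN.
by rewrite -sumrN; apply: eq_bigr => k _; rewrite mulrN.
Qed.

Lemma ideal_pow_mulS i a b : ideal_pow m i a -> m b -> ideal_pow m i.+1 (a * b).
Proof. by move=> Fa mb; exists 1%N, (fun=> a), (fun=> b); rewrite big_ord1. Qed.

Lemma ideal_pow_ind i (P : R -> Prop) : P 0 -> (forall x y, P x -> P y -> P (x + y)) ->
  (forall a b, ideal_pow m i a -> m b -> P (a * b)) ->
  forall x, ideal_pow m i.+1 x -> P x.
Proof.
move=> P0 PD PM x [N [a [b [ab ->]]]].
by elim/big_rec: _ => // k y _ Py; apply: PD => //; case: (ab k) => ? ?; apply: PM.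
Qed.

Lemma ideal_pow1 x : ideal_pow m 1 x <-> m x.
Proof.
split=> [|mx]; last by rewrite -(mul1r x); apply: ideal_pow_mulS.
case: idm => m0 mD _ ml _.
by apply: ideal_pow_ind => // a b _ mb; apply: ml.
Qed.

Lemma ideal_pow_filtration : filtration (ideal_pow m).
Proof.
split=> //; [exact: ideal_pow_zero|exact: ideal_powD|exact: ideal_powN|..].
  elim=> // i IH; apply: ideal_pow_ind.
  - exact: ideal_pow_zero.
  - exact: ideal_powD.
  - by move=> a b /IH Fa mb; apply: ideal_pow_mulS.
move=> i j x y Fx; elim: j y => [y _|j IH].
  rewrite addn0; case: i Fx => // i; move: x; apply: ideal_pow_ind.
  - by rewrite mul0r; apply: ideal_pow_zero.
  - by move=> u v Fu Fv; rewrite mulrDl; apply: ideal_powD.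
  - move=> a b Fa mb; rewrite -mulrA; apply: ideal_pow_mulS => //.
    by case: idm => _ _ _ _ mr; apply: mr.
apply: ideal_pow_ind.
- by rewrite mulr0; apply: ideal_pow_zero.
- by move=> u v Fu Fv; rewrite mulrDr; apply: ideal_powD.
by move=> a b /IH Fxa mb; rewrite mulrA addnS; apply: ideal_pow_mulS.
Qed.

End IdealPowers.

Section SkewPowerSeries.
Variables (R S : nzRingType) (m : R -> Prop) (sigma delta tau : R -> R).
Variables (phi : (nat -> R) -> S) (psi : S -> nat -> R).
Hypotheses (maxm : maximal_ideal m) (compR : filt_complete (ideal_pow m)).
Hypothesis sepR : separated (ideal_pow m).
Hypotheses (sigmaD : forall a b, sigma (a + b) = sigma a + sigma b)
  (sigmaM : forall a b, sigma (a * b) = sigma a * sigma b) (sigma1 : sigma 1 = 1)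
  (sigmaK : cancel sigma tau) (tauK : cancel tau sigma).
Hypotheses (deltaD : forall a b, delta (a + b) = delta a + delta b)
  (deltaM : forall a b, delta (a * b) = delta a * b + sigma a * delta b)
  (sigma_m : forall a, m a -> m (sigma a)) (delta_R : forall a, m (delta a))
  (delta_m : forall a, m a -> ideal_pow m 2 (delta a)).
Hypotheses (phiK : cancel phi psi) (psiK : cancel psi phi)
  (phiD : forall f g, phi (fun i => f i + g i) = phi f + phi g)
  (phi1 : phi (fun i => if i == 0%N then 1 else 0) = 1)
  (phiM : forall f g h,
    (forall t, madic_lim m (sps_mul_partial sigma delta f g t) (h t)) ->
    phi h = phi f * phi g).

Local Notation F := (ideal_pow m).
Local Notation sdw := (sdw sigma delta).

Let idm : ideal m. Proof. by case: maxm. Qed.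
Let filtF : filtration F := ideal_pow_filtration idm.

Lemma sigma0 : sigma 0 = 0.
Proof. by apply: (addrI (sigma 0)); rewrite -sigmaD !addr0. Qed.

Lemma delta0 : delta 0 = 0.
Proof. by apply: (addrI (delta 0)); rewrite -deltaD !addr0. Qed.

Lemma delta1 : delta 1 = 0.
Proof.
have := deltaM 1 1; rewrite !mulr1 sigma1 mul1r => H.
by apply: (addrI (delta 1)); rewrite addr0 -H.
Qed.

Lemma tauD a b : tau (a + b) = tau a + tau b.
Proof. by apply: (can_inj sigmaK); rewrite sigmaD !tauK. Qed.

Lemma tauM a b : tau (a * b) = tau a * tau b.
Proof. by apply: (can_inj sigmaK); rewrite sigmaM !tauK. Qed.

Lemma tau0 : tau 0 = 0.
Proof. by rewrite -{1}sigma0 sigmaK. Qed.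

(** The preimage of [m] under [sigma] is a proper ideal containing [m], hence equal to it by
    maximality. *)
Lemma tau_m a : m a -> m (tau a).
Proof.
move=> ma; case: (maxm) => [[m0 mD mN ml mr] m1 mmax].
have [|b|//|] := mmax (fun b => m (sigma b)); first split.
- by rewrite sigma0.
- by move=> x y mx my; rewrite sigmaD; apply: mD.
- move=> x mx; suff -> : sigma (- x) = - sigma x by apply: mN.
  by apply: (addrI (sigma x)); rewrite -sigmaD !subrr sigma0.
- by move=> x r mx; rewrite sigmaM; apply: ml.
- by move=> x r mx; rewrite sigmaM; apply: mr.
- exact: sigma_m.
- by apply; rewrite tauK.
by rewrite sigma1.
Qed.

Lemma sigma_filt i a : F i a -> F i (sigma a).
Proof.
elim: i a => // i IH; apply: ideal_pow_ind.
- by rewrite sigma0; apply: filt_zero.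
- by move=> x y; rewrite sigmaD; apply: filtD.
by move=> a b /IH Fa /sigma_m mb; rewrite sigmaM; apply: ideal_pow_mulS.
Qed.

Lemma tau_filt i a : F i a -> F i (tau a).
Proof.
elim: i a => // i IH; apply: ideal_pow_ind.
- by rewrite tau0; apply: filt_zero.
- by move=> x y; rewrite tauD; apply: filtD.
by move=> a b /IH Fa /tau_m mb; rewrite tauM; apply: ideal_pow_mulS.
Qed.

(** In the Leibniz rule for [a * b] with [b] in [m], the degree is gained on [a] by induction in one
    term, and on [b] by [delta_m] in the other. *)
Lemma delta_filt i a : F i a -> F i.+1 (delta a).
Proof.
elim: i a => [a _|i IH]; first exact/ideal_pow1.
apply: ideal_pow_ind.
- by rewrite delta0; apply: filt_zero.
- by move=> x y; rewrite deltaD; apply: filtD.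
move=> a b Fa mb; rewrite deltaM; apply: filtD => //.
  by apply: ideal_pow_mulS => //; apply: IH.
by rewrite -addn2; apply: filtM => //; [apply: sigma_filt|apply: delta_m].
Qed.

Lemma sdw0 i k : sdw i k 0 = 0.
Proof.
elim: i k => [|i IH] k /=; first by case: ifP.
by rewrite IH delta0 addr0; case: k => // k; rewrite IH sigma0.
Qed.

Lemma sdw1 i k : sdw i k 1 = if k == i then 1 else 0.
Proof.
elim: i k => [|i IH] k //=; rewrite IH.
case: k => [|k]; first by case: eqP; rewrite ?delta0 ?delta1 addr0.
rewrite IH eqSS; case: (k == i); case: eqP; rewrite ?delta0 ?delta1 ?sigma0 ?sigma1 addr0 //.
Qed.

(** A term in [x^k] arises from [i - k] applications of [delta], each worth one degree. *)
Lemma sdw_filt i k e b : F e b -> F (e + (i - k))%N (sdw i k b).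
Proof.
move=> Fb; elim: i k => [|i IH] k /=.
  by rewrite addn0; case: eqP => // _; apply: filt_zero.
apply: filtD => //.
  case: k => [|k]; first exact: filt_zero.
  by rewrite subSS; apply: sigma_filt.
by apply: (filt_leq filtF _ (delta_filt (IH k))); lia.
Qed.

Lemma sdw_gt i k b : (i < k)%N -> sdw i k b = 0.
Proof.
elim: i k => [|i IH] [|k] //= ik.
by rewrite !IH ?sigma0 ?delta0 ?addr0 // ltnW.
Qed.

Definition conv f g h :=
  forall t, madic_lim m (sps_mul_partial sigma delta f g t) (h t).

Lemma conv_const f g h : (forall t, exists M, forall N, (M <= N)%N ->
  sps_mul_partial sigma delta f g t N = h t) -> phi f * phi g = phi h.
Proof.
move=> H; apply/esym/phiM => t N; have [M HM] := H t; exists M => i /HM ->.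
by rewrite subrr; apply: filt_zero.
Qed.

Lemma conv_exists f g : exists h, conv f g h.
Proof.
have ex t : exists l, madic_lim m (sps_mul_partial sigma delta f g t) l.
  have [|l lim] := cauchy_series filtF compR (d := t)
      (c := fun i => \sum_(j < t.+1) f i * sdw i (t - j) (g j)).
    move=> i; apply: filt_sum => // j _; apply: filtMl => //.
    by apply: (filt_leq filtF _ (sdw_filt i (t - j) (filt0 filtF (g j)))); lia.
  exists l => N; exists (N + t)%N => i Ni.
  by apply: (filt_leq filtF _ (lim i)); lia.
exists (fun t => proj1_sig (constructive_indefinite_description _ (ex t))) => t.
exact: proj2_sig (constructive_indefinite_description _ (ex t)).
Qed.

Lemma phi0 : phi (fun=> 0) = 0.
Proof.
by apply: (addrI (phi (fun=> 0))); rewrite -phiD !addr0.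
Qed.

Lemma phiN f : phi (fun i => - f i) = - phi f.
Proof.
apply: (addrI (phi f)); rewrite -phiD subrr -phi0; congr (phi _).
by apply: functional_extensionality => i; rewrite subrr.
Qed.

Lemma phiB f g : phi (fun i => f i - g i) = phi f - phi g.
Proof. by rewrite -phiN -phiD. Qed.

Definition const a := phi (fun i => if i == 0%N then a else 0).
Definition var := phi (fun i => if i == 1%N then 1 else 0).

Lemma constD a b : const (a + b) = const a + const b.
Proof.
rewrite /const -phiD; congr (phi _); apply: functional_extensionality => i.
by case: eqP; rewrite ?addr0.
Qed.

Lemma const_mul a g : const a * phi g = phi (fun t => a * g t).
Proof.
apply: conv_const => t; exists 1%N => -[//|N] _.
rewrite /sps_mul_partial big_ord_recl /= [X in _ + X]big1 ?addr0 => [|i _].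
  rewrite big_ord_recr /= subnn eqxx big1 ?add0r // => j _.
  by rewrite subn_eq0 leqNgt ltn_ord mulr0.
by rewrite big1 // => j _; rewrite mul0r.
Qed.

Lemma constM a b : const (a * b) = const a * const b.
Proof.
rewrite const_mul; congr (phi _); apply: functional_extensionality => i.
by case: eqP; rewrite ?mulr0.
Qed.

Lemma mul_var f : phi f * var = phi (fun t => if t is t'.+1 then f t' else 0).
Proof.
apply: conv_const => -[|t].
  exists 0%N => N _; rewrite /sps_mul_partial big1 // => i _.
  by rewrite big_ord1 /= sdw0 mulr0.
(* Only [i = t] and [j = 1] contribute. *)
exists t.+1 => N tN; rewrite /sps_mul_partial (bigD1 (Ordinal tN)) //= [X in _ + X]big1.
  rewrite addr0 big_ord_recl big_ord_recl /= sdw0 mulr0 add0r big1 => [|j _].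
    by rewrite addr0 subSS subn0 sdw1 eqxx mulr1.
  by rewrite sdw0 mulr0.
move=> i ni; rewrite big1 // => j _; case: (eqVneq (j : nat) 1%N) => [->|_].
  rewrite subSS subn0 sdw1 ifF ?mulr0 //.
  by apply/negbTE; apply: contra ni => /eqP ti; apply/eqP/val_inj.
by rewrite sdw0 mulr0.
Qed.

Lemma var_const b : var * const b = const (sigma b) * var + const (delta b).
Proof.
rewrite [const (sigma b) * _]mul_var -phiD.
apply: conv_const => t; exists 2%N => -[|[|N]] // _.
rewrite /sps_mul_partial 2!big_ord_recl /= [X in _ + (_ + X)]big1 => [|i _]; last first.
  by rewrite big1 // => j _; rewrite mul0r.
rewrite big1 ?add0r ?addr0 => [|j _]; last by rewrite mul0r.
rewrite big_ord_recl /= mul1r subn0 [X in _ + X]big1 ?addr0 => [|j _]; last first.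
  rewrite if_same delta0 addr0 mul1r.
  by case: (_ - _)%N => // k; rewrite if_same sigma0.
by case: t => [|[|t]] //=; rewrite ?delta0 ?sigma0.
Qed.

Lemma phi_split D f :
  phi f = \sum_(j < D) const (f j) * var ^+ j + phi (fun i => f (i + D)%N) * var ^+ D.
Proof.
elim: D => [|D ->].
  rewrite big_ord0 add0r mulr1; congr (phi _).
  by apply: functional_extensionality => i; rewrite addn0.
rewrite big_ord_recr /= -addrA; congr (_ + _).
have -> : phi (fun i => f (i + D)%N) = const (f D) + phi (fun i => f (i + D.+1)%N) * var.
  rewrite mul_var -phiD; congr (phi _); apply: functional_extensionality => -[|i] /=.
    by rewrite addr0.
  by rewrite add0r addSnnS.
by rewrite mulrDl -mulrA -exprS.
Qed.

(** The weight filtration, with [x] of weight one; [wfiltE] identifies it with the adic filtration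
    of the maximal ideal. *)
Definition wfilt i s := forall j, F (i - j)%N (psi s j).

Lemma wfilt_phi i f : wfilt i (phi f) <-> forall j, F (i - j)%N (f j).
Proof. by rewrite /wfilt phiK. Qed.

Lemma psiD s t j : psi (s + t) j = psi s j + psi t j.
Proof. by rewrite -{1}(psiK s) -{1}(psiK t) -phiD phiK. Qed.

Lemma psiN s j : psi (- s) j = - psi s j.
Proof. by rewrite -{1}(psiK s) -phiN phiK. Qed.

Lemma wfilt_filtration : filtration wfilt.
Proof.
split.
- by move=> s j; rewrite sub0n; apply: filt0.
- by move=> i; rewrite -phi0; apply/wfilt_phi => j; apply: filt_zero.
- by move=> i s t Ws Wt j; rewrite psiD; apply: filtD.
- by move=> i s Ws j; rewrite psiN; apply: filtN.
- by move=> i s Ws j; apply: (filt_leq filtF _ (Ws j)); apply: leq_sub2r.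
move=> i j s t Ws Wt; rewrite -(psiK s) -(psiK t).
have [h ch] := conv_exists (psi s) (psi t).
rewrite -(phiM ch); apply/wfilt_phi => k.
(* Coefficient [k] of the product is a limit, replaced here by a partial sum that agrees with it to
   the required precision. *)
have [M HM] := ch k (i + j - k)%N.
set p := sps_mul_partial sigma delta (psi s) (psi t) k in HM *.
rewrite -(subrK (p M) (h k)); apply: filtD => //.
  by rewrite -opprB; apply: filtN => //; apply: HM.
apply: filt_sum => // a _; apply: filt_sum => // b _.
have [ka|ak] := leqP (k - b) a; last by rewrite sdw_gt // mulr0; apply: filt_zero.
apply: (filt_leq filtF (j := (i - a + (j - b + (a - (k - b))))%N)).
  by have := ltn_ord b; lia.
by apply: filtM => //; apply: sdw_filt.
Qed.
Let filtW := wfilt_filtration.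

Lemma wfilt_const i a : wfilt i (const a) <-> F i a.
Proof.
split=> [/wfilt_phi /(_ 0%N)|Fa]; first by rewrite subn0.
by apply/wfilt_phi => -[|j] /=; rewrite ?subn0 //; apply: filt_zero.
Qed.

Lemma wfilt1_phi f : F 1%N (f 0%N) -> wfilt 1 (phi f).
Proof. by move=> F0; apply/wfilt_phi => -[|j] //; rewrite subSS; apply: filt0. Qed.

Lemma wfilt_var : wfilt 1 var.
Proof. by apply: wfilt1_phi; exact: (filt_zero filtF 1). Qed.

Variable nn : S -> Prop.
Hypotheses (maxnn : maximal_ideal nn)
  (uniq_nn : forall J, maximal_ideal J -> forall s, J s <-> nn s).

(** An ideal that strictly contains [wfilt 1] has an element with constant term outside [m]; its
    preimage in [R] is then larger than [m], so contains 1. *)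
Lemma wfilt1_maximal : maximal_ideal (wfilt 1).
Proof.
split.
- split; [exact: filt_zero filtW _|exact: filtD filtW _|exact: filtN filtW _|..].
    by move=> s t; apply: filtMl filtW _ _ _.
  by move=> s t; apply: filtMr filtW _ _ _.
- by rewrite -phi1 => /wfilt_const /(ideal_pow1 idm); case: maxm.
move=> J [J0 JD JN Jl Jr] WJ; have [sub|nsub] := classic (forall s, J s -> wfilt 1 s).
  by left.
right; have [s [Js nWs]] : exists s, J s /\ ~ wfilt 1 s.
  by apply: NNPP => H; apply: nsub => s Js; apply: NNPP => nW; apply: H; exists s.
have Jm a : m a -> J (const a).
  by move=> ma; apply: WJ; apply/wfilt_const/ideal_pow1.
have Js0 : J (const (psi s 0%N)).
  rewrite -(subrK s (const _)); apply: JD => //; apply: WJ.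
  rewrite -{2}(psiK s) -phiB; apply: wfilt1_phi.
  by rewrite eqxx subrr; apply: (filt_zero filtF 1).
have const0 : const 0 = 0.
  by apply: (addrI (const 0)); rewrite -constD !addr0.
rewrite -phi1; case: (maxm) => _ _ /(_ (fun a => J (const a))) [||sub|//].
- split=> [|a b Ja Jb|a Ja|a b Ja|a b Ja].
  + by rewrite const0.
  + by rewrite constD; apply: JD.
  + suff -> : const (- a) = - const a by apply: JN.
    by apply: (addrI (const a)); rewrite -constD !subrr const0.
  + by rewrite constM; apply: Jl.
  + by rewrite constM; apply: Jr.
- exact: Jm.
case: nWs; rewrite -(psiK s); apply: wfilt1_phi.
by apply/(ideal_pow1 idm); apply: sub.
Qed.

(** Uniqueness of the maximal ideal gives degree 1. One inclusion splits off the constant term and a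
    right factor [var]; the other is multiplicativity of the weight filtration. *)
Lemma wfiltE i s : wfilt i s <-> ideal_pow nn i s.
Proof.
have [idnn _ _] := maxnn.
have W1 t : wfilt 1 t <-> nn t by apply: uniq_nn; apply: wfilt1_maximal.
have filtnn := ideal_pow_filtration idnn.
split=> [|Ns].
  rewrite -(psiK s); elim: i (psi s) => // i IH f /wfilt_phi Wf.
  rewrite (phi_split 1 f) big_ord1 mulr1; apply: filtD => //; last first.
    apply: ideal_pow_mulS.
      by apply: IH; apply/wfilt_phi => j; move: (Wf (j + 1)%N); rewrite addn1 subSS.
    exact/W1/wfilt_var.
  move: (Wf 0%N); rewrite subn0; move: (f 0%N) => a {Wf IH}.
  elim: i a => [|i IH] a.
    by move=> Fa; apply/ideal_pow1 => //; apply/W1/wfilt_const.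
  move: a; apply: ideal_pow_ind.
  - rewrite (_ : const 0 = 0); first exact: filt_zero.
    by apply: (addrI (const 0)); rewrite -constD !addr0.
  - by move=> x y Nx Ny; rewrite constD; apply: filtD.
  move=> a b /IH Na mb; rewrite constM; apply: ideal_pow_mulS => //.
  by apply/W1/wfilt_const/ideal_pow1.
elim: i s Ns => [s _|i IH]; first exact: filt0 filtW _.
apply: ideal_pow_ind.
- exact: filt_zero filtW _.
- by move=> s t; apply: filtD filtW _ _ _.
by move=> s t /IH Ws /W1 Wt; rewrite -addn1; apply: filtM filtW _ _ _ _ Ws Wt.
Qed.

Lemma wfilt_separated : separated wfilt.
Proof.
move=> s Ws; rewrite -(psiK s) -phi0; congr (phi _); apply: functional_extensionality => j.
by apply: sepR => N; move: (Ws (N + j)%N j); rewrite addnK.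
Qed.

Lemma wfilt_complete : filt_complete wfilt.
Proof.
move=> u cau.
have psiB s t j : psi (s - t) j = psi s j - psi t j by rewrite psiD psiN.
have ex j : exists l, forall N, exists M, forall i, (M <= i)%N -> F N (psi (u i) j - l).
  apply: compR => N; have [M HM] := cau (N + j)%N; exists M => a b Ma Mb.
  by move: (HM a b Ma Mb j); rewrite psiB addnK.
pose l j := proj1_sig (constructive_indefinite_description _ (ex j)).
have lim j : forall N, exists M, forall i, (M <= i)%N -> F N (psi (u i) j - l j).
  exact: proj2_sig (constructive_indefinite_description _ (ex j)).
exists (phi l) => N; have [M HM] := cau N; exists M => i Mi j.
(* [M] is uniform in [j], whereas [M'] depends on it; the comparison passes through the later index
   [M + M']. *)
rewrite psiB phiK; have [M' HM'] := lim j (N - j)%N.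
rewrite -(subrK (psi (u (M + M')%N) j) (psi (u i) j)) -addrA; apply: filtD => //.
  by rewrite -psiB; apply: HM => //; apply: leq_addr.
by apply: HM'; apply: leq_addl.
Qed.

Lemma wfilt_skew_ext : skew_ext F wfilt const var sigma tau.
Proof.
split=> //.
- exact: constD.
- exact: constM.
- by move=> i a Fa; apply/wfilt_const.
- exact: wfilt_var.
- exact: sigma_filt.
- exact: tau_filt.
- by move=> i a Fa; exists (delta a); [apply: delta_filt|apply: var_const].
- move=> i s Ws; exists (psi s) => //.
  rewrite -{1}(psiK s) (phi_split i.+1) addrAC subrr add0r.
  by apply: filtMl filtW _ _ _ _; apply: filtX filtW _ _ wfilt_var.
move=> i r Fr; pose f j := if (j <= i)%N then r j else 0.
have -> : \sum_(j < i.+1) const (r j) * var ^+ j = phi f.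
  rewrite (phi_split i.+1 f) (_ : (fun _ => _) = fun=> 0) ?phi0 ?mul0r ?addr0.
    by apply: eq_bigr => j _; rewrite /f -ltnS ltn_ord.
  by apply: functional_extensionality => j; rewrite /f ifF //; lia.
by move=> /wfilt_phi Wf j ji; move: (Wf j); rewrite /f ji subSn.
Qed.

Lemma sps_tower n : tower n F -> tower n.+1 (ideal_pow nn).
Proof.
move=> towF; have -> : ideal_pow nn = wfilt.
  apply: functional_extensionality => i; apply: functional_extensionality => s.
  by apply: propositional_extensionality; rewrite wfiltE.
exact: towerS towF filtW wfilt_separated wfilt_complete wfilt_skew_ext.
Qed.

End SkewPowerSeries.

(** * Krull dimension *)

Lemma SPSn_tower (k : nzRingType) n (S : nzRingType) (nn : S -> Prop) :
  division_ring k -> SPSn k n S -> maximal_ideal nn ->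
  (forall J, maximal_ideal J -> forall x, J x <-> nn x) -> tower n (ideal_pow nn).
Proof.
move=> divk spsS; elim: spsS nn => {n S} [|n T S _ IH inS] nn maxnn uniqnn.
  have [idnn nn1 _] := maxnn; apply: tower0 => //; first exact: ideal_pow_filtration.
  (* A nonzero element of [nn] would be a unit, putting 1 in [nn]. *)
  move=> x /(ideal_pow1 idnn) nx; apply/eqP/negPn/negP => /divk [y [xy _]].
  by case: idnn => _ _ _ _ mr; apply: nn1; rewrite -xy; apply: mr.
have [m [sigma [delta [phi [[compT skew [psi phiK psiK]] [phiD phi1 phiM]]]]]] := inS.
have [[maxm uniqm _] sepT limT] := compT.
have [[sD sM s1 [tau sK tK]] [dD dM sm dR dm]] := skew.
exact: (sps_tower (psi := psi) (tau := tau) maxm limT sepT sD sM s1 sK tK dD dM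
  sm dR dm phiK psiK phiD phi1 phiM maxnn uniqnn (IH m maxm uniqm)).
Qed.

Lemma devlt_converse (R : nzRingType) n (A B : R -> Prop) :
  devlt (G := R^c) true n A B <-> devlt (G := R) false n A B.
Proof.
elim: n A B => //= n IH A B; split=> dAB c idc Ac cB desc.
  by have [N HN] := dAB c idc Ac cB desc; exists N => i /HN; apply IH.
by have [N HN] := dAB c idc Ac cB desc; exists N => i /HN; apply IH.
Qed.

Lemma Kdim_eq_converse (R : nzRingType) n : Kdim_eq R^c true n -> Kdim_eq R false n.
Proof. by move=> [up low]; split; [apply/devlt_converse|move=> /devlt_converse]. Qed.

Lemma tower_Kdim n (S : nzRingType) (E : nat -> S -> Prop) :
  tower n E -> Kdim_eq S true n.
Proof.
move=> towE; have [lead leadE] := tower_lead towE; split.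
  exact: devlt_complete (tower_filt towE) (tower_separated towE) (tower_complete towE) leadE.
by move=> /(devlt_devcl E); apply: tower_devcl towE.
Qed.

Lemma graded_Kdim n (S G : nzRingType) (E : nat -> S -> Prop) (phi : nat -> S -> G) :
  tower n E -> graded_of E phi -> Kdim_eq G true n.
Proof.
move=> towE grG; have filtE := tower_filt towE.
have [lead leadE] := tower_lead towE; split.
  exact: devlt_graded filtE grG _ _ leadE.
move=> dG; apply: (tower_devcl towE); apply: (devlt_gr filtE grG) => //.
- exact: side_ideal_zero.
- exact: filt_closed_zero (tower_separated towE).
have -> : gr_ideal E phi (fun s => s = 0) = (fun g => g = 0).
  apply: functional_extensionality => g; apply: propositional_extensionality; split.
    exact: gr_zero.
  by move=> ->; have [] := gr_side_ideal filtE grG (side_ideal_zero S true).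
have -> // : gr_ideal E phi (fun=> True) = fun=> True.
apply: functional_extensionality => g; apply: propositional_extensionality.
by split=> // _; apply: gr_full.
Qed.

Theorem theorem4p3 (k : nzRingType) (n : nat) (S : nzRingType)
  (nn : S -> Prop) (G : nzRingType) :
  division_ring k -> SPSn k n S ->
  maximal_ideal nn -> (forall J, maximal_ideal J -> forall x, J x <-> nn x) ->
  assoc_graded nn G ->
  [/\ Kdim_eq S true n, Kdim_eq S false n, Kdim_eq G true n & Kdim_eq G false n].
Proof.
move=> divk spsS maxnn uniqnn [phi [pD p0 pM pgen pdir]].
have towS := SPSn_tower divk spsS maxnn uniqnn.
have grG : graded_of (ideal_pow nn) phi by split.
have towSc := tower_converse towS; have grGc := graded_converse grG.
split.
- exact: tower_Kdim towS.
- exact/Kdim_eq_converse/tower_Kdim/towSc.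
- exact: graded_Kdim towS grG.
- exact/Kdim_eq_converse/(graded_Kdim towSc grGc).
Qed.
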